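(* Let $H$ be a group with Kazhdan's property (T) acting by isometric automorphisms on a metric median algebra $(X,d,\mu)$ which is uniformly rectifiable and of finite rank, and such that $(X,d)$ is complete and connected. Then the action has a fixed point.
   Context: A median algebra is a set $M$ with a ternary operation $\mu$ such that $\mu(x,y,z)=\mu(x,z,y)=\mu(y,z,x)$, $\mu(x,x,y)=x$ and $\mu(\mu(x,y,z),u,v)=\mu(x,\mu(y,u,v),\mu(z,u,v))$ for all $x,y,z,u,v$. The median interval is $I(x,y)=\{z:\mu(x,y,z)=z\}$; a subset is convex if it contains $I(a,b)$ for all its elements $a,b$; a subalgebra is a subset closed under $\mu$. A wall is a partition $M=h\sqcup h^c$ into two non-empty convex subsets; it separates $a,b$ if they lie in different parts; $\mathcal{W}(M)$ is the set of walls and $\mathcal{W}^M(a|b)$ the set of walls separating $a,b$. Every finite median algebra $M$ is the vertex set of a finite $\mathrm{CAT}(0)$ cube complex $\mathscr{C}(M)$ whose edges join $x,y$ exactly when a unique wall of $M$ separates them; the rank of a finite median algebra is the dimension of $\mathscr{C}(M)$, and the rank of a general median algebra is the supremum of ranks of its finite subalgebras. A metric median algebra $(X,d,\mu)$ is a median algebra $(X,\mu)$ with a metric $d$ for which $\mu$ is continuous; an isometric automorphism is an isometry of $(X,d)$ commuting with $\mu$. For a finite subalgebra $M$ and $W\in\mathcal{W}(M)$, let $\lambda^M_{\max}(W)=\max d(a,b)$ over edges $\{a,b\}$ of $\mathscr{C}(M)$ separated by $W$; for $x,y\in X$ set $d^M_\mu(x,y)=\sum_{W\in\mathcal{W}^M(x|y)}\lambda^M_{\max}(W)$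 if $x,y\in M$ and $0$ otherwise, and $d_\mu(x,y)=\sup_M d^M_\mu(x,y)\in[0,\infty]$ over all finite subalgebras $M$. $(X,d,\mu)$ is uniformly rectifiable if there is $L\ge0$ with $d_\mu(x,y)\le L\,d(x,y)$ for all $x,y$. *)

(* Defs.v *)
From HB Require Import structures.
From mathcomp Require Import all_boot all_order all_algebra.
From mathcomp Require Import finmap.
From mathcomp Require Import complex.
From mathcomp Require Import boolp classical_sets reals constructive_ereal ereal.
Set Implicit Arguments. Unset Strict Implicit. Unset Printing Implicit Defensive.
Import Order.TTheory GRing.Theory Num.Theory.
Local Open Scope ring_scope.

Definition is_group (G : Type) (mul : G -> G -> G) (one : G) (inv : G -> G) : Prop :=
  [/\ forall a b c, mul a (mul b c) = mul (mul a b) c,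
      forall a, mul one a = a /\ mul a one = a
    & forall a, mul (inv a) a = one /\ mul a (inv a) = one].

Section Hilbert.
Variable R : realType.
Variable V : lmodType R[i].
Variable ip : V -> V -> R[i].

Definition hnorm (v : V) : R := Num.sqrt (complex.Re (ip v v)).

Definition is_hilbert : Prop :=
  [/\ (forall (a : R[i]) (u v w : V), ip (a *: u + v) w = a * ip u w + ip v w),
      (forall u v, ip u v = conjc (ip v u)),
      (forall v, 0 <= ip v v),
      (forall v, ip v v = 0 -> v = 0)
    & (forall u : nat -> V,
         (forall e : R, 0 < e -> exists N, forall m n, (N <= m)%N -> (N <= n)%N ->
             hnorm (u m - u n) < e) ->
         exists l : V, forall e : R, 0 < e -> exists N, forall n, (N <= n)%N ->
             hnorm (u n - l) < e)].

Definition unitary_rep (G : Type) (mul : G -> G -> G) (one : G) (pi : G -> V -> V) : Prop :=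
  [/\ (forall g (a : R[i]) u v, pi g (a *: u + v) = a *: pi g u + pi g v),
      (forall g u v, ip (pi g u) (pi g v) = ip u v),
      (forall v, pi one v = v)
    & (forall g h v, pi (mul g h) v = pi g (pi h v))].

(* almost invariant vectors (G discrete: compact subsets are finite) *)
Definition almost_invariant_vectors (G : Type) (pi : G -> V -> V) : Prop :=
  forall (n : nat) (Q : 'I_n -> G) (e : R), 0 < e ->
    exists v : V, hnorm v = 1 /\ forall i, hnorm (pi (Q i) v - v) < e.

Definition nonzero_invariant_vector (G : Type) (pi : G -> V -> V) : Prop :=
  exists v : V, v <> 0 /\ forall g, pi g v = v.
End Hilbert.

Definition property_T (R : realType) (G : Type) (mul : G -> G -> G) (one : G)
    (inv : G -> G) : Prop :=
  forall (V : lmodType R[i]) (ip : V -> V -> R[i]) (pi : G -> V -> V),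
    is_hilbert ip -> unitary_rep ip mul one pi ->
    almost_invariant_vectors ip pi -> nonzero_invariant_vector pi.

Definition median_algebra (X : Type) (mu : X -> X -> X -> X) : Prop :=
  [/\ forall x y z, mu x y z = mu x z y /\ mu x y z = mu y z x,
      forall x y, mu x x y = x
    & forall x y z u v, mu (mu x y z) u v = mu x (mu y u v) (mu z u v)].

Section Metric.
Variables (R : realType) (X : Type) (d : X -> X -> R).

Definition is_metric : Prop :=
  [/\ forall x y, 0 <= d x y,
      forall x y, d x y = 0 <-> x = y,
      forall x y, d x y = d y x
    & forall x y z, d x z <= d x y + d y z].

Definition metric_open (A : X -> Prop) : Prop :=
  forall a, A a -> exists2 r : R, 0 < r & forall b, d a b < r -> A b.

Definition metric_connected : Prop :=
  (exists x : X, True) /\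
  forall A : X -> Prop, metric_open A -> metric_open (fun x => ~ A x) ->
    (forall x, A x) \/ (forall x, ~ A x).

Definition metric_complete : Prop :=
  forall u : nat -> X,
    (forall e : R, 0 < e -> exists N, forall m n, (N <= m)%N -> (N <= n)%N -> d (u m) (u n) < e) ->
    exists l : X, forall e : R, 0 < e -> exists N, forall n, (N <= n)%N -> d (u n) l < e.

Definition continuous3 (mu : X -> X -> X -> X) : Prop :=
  forall x y z (e : R), 0 < e -> exists2 r : R, 0 < r &
    forall x' y' z', d x x' < r -> d y y' < r -> d z z' < r -> d (mu x y z) (mu x' y' z') < e.

Definition metric_median_algebra (mu : X -> X -> X -> X) : Prop :=
  [/\ median_algebra mu, is_metric & continuous3 mu].
End Metric.

Section Finite.
Variables (R : realType) (X : choiceType) (d : X -> X -> R) (mu : X -> X -> X -> X).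

Definition subalgebra (M : {fset X}) : Prop :=
  forall a b c, a \in M -> b \in M -> c \in M -> mu a b c \in M.

(* h is convex in M: it contains the (M-)median interval I(a,b) of any a,b in h *)
Definition convex_in (M h : {fset X}) : bool :=
  all (fun a => all (fun b => all (fun c => (mu a b c == c) ==> (c \in h)) M) h) h.

(* h is one side of a wall of M (a wall is {h, M \ h}) *)
Definition halfspace (M h : {fset X}) : bool :=
  [&& (h `<=` M)%fset, h != fset0, (M `\` h)%fset != fset0, convex_in M h
    & convex_in M (M `\` h)%fset].

(* the walls of M separating a and b, each represented by its side containing a *)
Definition sep_half (M : {fset X}) (a b : X) : {fset {fset X}} :=
  [fset h in fpowerset M | halfspace M h && (a \in h) && (b \notin h)]%fset.

(* edges of the cube complex C(M): exactly one wall separates a and b *)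
Definition edge (M : {fset X}) (a b : X) : bool :=
  [&& a \in M, b \in M & #|` sep_half M a b|%fset == 1%N].

Definition lambda_max (M h : {fset X}) : R :=
  \big[Num.max/0]_(a <- M) \big[Num.max/0]_(b <- M | edge M a b && (a \in h) && (b \notin h))
     d a b.

Definition dM (M : {fset X}) (x y : X) : R :=
  if (x \in M) && (y \in M) then \sum_(h <- sep_half M x y) lambda_max M h else 0.

Definition d_mu (x y : X) : \bar R :=
  ereal_sup [set (dM M x y)%:E | M in [set M : {fset X} | subalgebra M]].

Definition uniformly_rectifiable : Prop :=
  exists2 L : R, 0 <= L & forall x y, (d_mu x y <= (L * d x y)%:E)%E.

Definition has_cube (M : {fset X}) (n : nat) : Prop :=
  exists f : {ffun 'I_n -> bool} -> X,
    [/\ injective f, forall v, f v \in M &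
        forall v w : {ffun 'I_n -> bool}, #|[set i | v i != w i]| = 1%N -> edge M (f v) (f w)].

(* rank(M) = dim C(M); rank(X) = sup of ranks of finite subalgebras *)
Definition finite_rank : Prop :=
  exists N : nat, forall M n, subalgebra M -> has_cube M n -> (n <= N)%N.
End Finite.

Definition isometric_action (R : realType) (G X : Type) (mul : G -> G -> G) (one : G)
    (d : X -> X -> R) (mu : X -> X -> X -> X) (act : G -> X -> X) : Prop :=
  [/\ forall x, act one x = x,
      forall g h x, act (mul g h) x = act g (act h x),
      forall g x y, d (act g x) (act g y) = d x y
    & forall g x y z, act g (mu x y z) = mu (act g x) (act g y) (act g z)].

(* Main.v *)
Require Import Defs.
From HB Require Import structures.
From mathcomp Require Import all_boot all_order all_algebra.
From mathcomp Require Import finmap complex.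
From mathcomp Require Import boolp classical_sets reals constructive_ereal ereal.
From mathcomp Require Import functions topology normedtype sequences exp.
From mathcomp Require Import ring lra.

(** The supremum [delta] of the metrics [dM] over finite subalgebras is bi-Lipschitz to
    [d] and invariant under the action; it is additive on median intervals because each
    [dM] is a weighted count of separating walls and [dM] converges to [delta] along
    the finite subalgebras.

    Bounded orbits. Each [exp (- t delta)] is a positive definite kernel, being a limit
    of products of two-valued kernels, one for each wall. Property (T), applied to the
    direct sum of the reproducing kernel Hilbert spaces of [exp (- delta / n)], yields a
    nonzero invariant function of finite norm; on an unbounded orbit such a function
    would have infinite norm.

    Fixed point. Let [dinf x y] be the supremum of [f y - f x] over the 1-Lipschitz
    functions [f] that are monotone on intervals. Balls of [dinf] are convex. Since at
    most [rank] walls are pairwise transverse, a heavy chain of walls (and an ultralimit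
    over finite subalgebras) shows [delta <= rank * dinf]. Connectedness and the Helly
    property make [dinf] hyperconvex up to arbitrarily small errors. As in Lang's fixed
    point theorem for injective spaces, the circumradius function of an orbit is then
    improved to almost extremal invariant functions, whose almost centers converge to a
    fixed point. *)

Set Implicit Arguments.
Unset Strict Implicit.
Unset Printing Implicit Defensive.
Import Order.TTheory GRing.Theory Num.Theory numFieldNormedType.Exports.
Local Open Scope ring_scope.
Local Open Scope classical_set_scope.

(** * Positive definite kernels *)

Section Kernels.
Variable R : realFieldType.

Definition bform (Y : Type) (K : Y -> Y -> R) (l l' : seq (R * Y)) : R :=
  \sum_(p <- l) \sum_(q <- l') p.1 * q.1 * K p.2 q.2.

Definition pos_def (Y : Type) (K : Y -> Y -> R) : Prop := forall l, 0 <= bform K l l.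

Lemma bform_pullback (Y Z : Type) (K : Y -> Y -> R) (a : Z -> R) (phi : Z -> Y) l l' :
  bform (fun x y => a x * a y * K (phi x) (phi y)) l l' =
  bform K [seq (p.1 * a p.2, phi p.2) | p <- l] [seq (p.1 * a p.2, phi p.2) | p <- l'].
Proof.
rewrite /bform big_map; apply: eq_bigr => p _; rewrite big_map; apply: eq_bigr => q _ /=.
by ring.
Qed.

Lemma pos_def_pullback (Y Z : Type) (K : Y -> Y -> R) (a : Z -> R) (phi : Z -> Y) :
  pos_def K -> pos_def (fun x y => a x * a y * K (phi x) (phi y)).
Proof. by move=> Kpos l; rewrite bform_pullback. Qed.

Lemma eq_pos_def (Y : Type) (K K' : Y -> Y -> R) :
  (forall x y, K x y = K' x y) -> pos_def K -> pos_def K'.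
Proof. by move=> KK'; congr pos_def; do 2!apply/funext => ?. Qed.

Lemma pos_def_comp (Y Z : Type) (K : Y -> Y -> R) (phi : Z -> Y) :
  pos_def K -> pos_def (fun x y => K (phi x) (phi y)).
Proof.
move=> /(pos_def_pullback (fun=> 1) phi); apply: eq_pos_def => x y.
by rewrite !mul1r.
Qed.

Lemma pos_def1 (Y : Type) : pos_def (fun _ _ : Y => 1).
Proof.
move=> l; suff -> : bform (fun _ _ => 1) l l = (\sum_(p <- l) p.1) ^+ 2 by exact: sqr_ge0.
rewrite /bform expr2 mulr_suml; apply: eq_bigr => p _; rewrite mulr_sumr.
by apply: eq_bigr => q _; rewrite mulr1.
Qed.

Lemma pos_defD (Y : Type) (K K' : Y -> Y -> R) :
  pos_def K -> pos_def K' -> pos_def (fun x y => K x y + K' x y).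
Proof.
move=> Kpos K'pos l.
suff -> : bform (fun x y => K x y + K' x y) l l = bform K l l + bform K' l l.
  by rewrite addr_ge0.
rewrite /bform -big_split; apply: eq_bigr => p _; rewrite -big_split; apply: eq_bigr => q _ /=.
by rewrite mulrDr.
Qed.

Lemma pos_defZ (Y : Type) (c : R) (K : Y -> Y -> R) :
  0 <= c -> pos_def K -> pos_def (fun x y => c * K x y).
Proof.
move=> c_ge0 Kpos l; suff -> : bform (fun x y => c * K x y) l l = c * bform K l l.
  by rewrite mulr_ge0.
rewrite /bform mulr_sumr; apply: eq_bigr => p _; rewrite mulr_sumr; apply: eq_bigr => q _ /=.
by ring.
Qed.

(* The factor is the convex combination c + (1 - c) (1_h 1_h + 1_h^c 1_h^c). *)
Lemma pos_def_wall (Y : Type) (h : pred Y) (c : R) (K : Y -> Y -> R) :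
  0 <= c <= 1 -> pos_def K -> pos_def (fun x y => (if h x == h y then 1 else c) * K x y).
Proof.
move=> /andP[c_ge0 c_le1] Kpos; pose ind b x : R := (h x == b)%:R.
have indK b : pos_def (fun x y => ind b x * ind b y * K x y).
  exact: (pos_def_pullback (ind b) id).
apply: (@eq_pos_def _ (fun x y => c * K x y + (1 - c) *
  (ind true x * ind true y * K x y + ind false x * ind false y * K x y))) => [x y|].
  by rewrite /ind; case: (h x); case: (h y) => /=; ring.
by apply: pos_defD; apply: pos_defZ; rewrite ?subr_ge0 //; apply: pos_defD.
Qed.

Lemma pos_def_prod_walls (Y I : Type) (s : seq I) (P : pred I) (h : I -> pred Y) (c : I -> R) :
  (forall i, 0 <= c i <= 1) ->
  pos_def (fun x y => \prod_(i <- s | P i) (if h i x == h i y then 1 else c i)).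
Proof.
move=> c01; elim: s => [|i s IH].
  by apply: eq_pos_def (@pos_def1 Y) => x y; rewrite big_nil.
have [Pi|nPi] := boolP (P i).
  apply: eq_pos_def (pos_def_wall (h i) (c01 i) IH) => x y.
  by rewrite big_cons Pi.
by apply: eq_pos_def IH => x y; rewrite big_cons (negPf nPi).
Qed.

Definition direct_sum_kernel (Y : Type) (I : eqType) (K : I -> Y -> Y -> R) (x y : Y * I) : R :=
  if x.2 == y.2 then K x.2 x.1 y.1 else 0.

Lemma bform_direct_sum_level (Y : Type) (I : eqType) (K : I -> Y -> Y -> R) (i : I)
    (l : seq (R * (Y * I))) :
  let on := [seq p <- l | p.2.2 == i] in let off := [seq p <- l | p.2.2 != i] in
  bform (direct_sum_kernel K) l l =
  bform (fun x y => K i x.1 y.1) on on + bform (direct_sum_kernel K) off off.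
Proof.
rewrite /= /bform !big_filter (bigID (fun p => p.2.2 == i)) /=.
congr (_ + _); apply: eq_bigr => p pi; rewrite big_filter (bigID (fun p => p.2.2 == i)) /=.
  rewrite [X in _ + X]big1 => [|q /negPf qi].
    by rewrite addr0; apply: eq_bigr => q qi; rewrite /direct_sum_kernel (eqP pi) (eqP qi) eqxx.
  by rewrite /direct_sum_kernel (eqP pi) eq_sym qi mulr0.
rewrite [X in X + _]big1 ?add0r // => q qi.
by rewrite /direct_sum_kernel (eqP qi) (negPf pi) mulr0.
Qed.

Lemma pos_def_direct_sum (Y : Type) (I : eqType) (K : I -> Y -> Y -> R) :
  (forall i, pos_def (K i)) -> pos_def (direct_sum_kernel K).
Proof.
move=> Kpos l; have [n] := ubnP (size l); elim: n l => // n IH [|p l] size_l.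
  by rewrite /bform big_nil.
rewrite (bform_direct_sum_level K p.2.2); apply: addr_ge0.
  exact: (pos_def_comp fst (Kpos _)).
apply: IH; rewrite /= eqxx size_filter; exact: leq_ltn_trans (count_size _ l) size_l.
Qed.

End Kernels.

Lemma pos_def_cvg (R : realType) (T Y : Type) (F : set_system T) {FF : ProperFilter F}
    (K : T -> Y -> Y -> R) (K' : Y -> Y -> R) :
  (forall i, pos_def (K i)) -> (forall x y, K i x y @[i --> F] --> K' x y) -> pos_def K'.
Proof.
move=> K_pos K_cvg l.
have bform_cvg : bform (K i) l l @[i --> F] --> bform K' l l.
  apply: cvg_big => [|p _]; first exact: add_continuous.
  apply: cvg_big => [|q _]; first exact: add_continuous.
  exact: cvgM (cvg_cst _) (K_cvg _ _).
by apply: (cvgr_to_ge bform_cvg); apply: filterE => i; exact: K_pos.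
Qed.

(** * Reproducing kernel Hilbert spaces *)

Section Convergence.
Variable R : realType.

Definition cauchy_wrt (T : Type) (rho : T -> T -> R) (u : nat -> T) : Prop :=
  forall e : R, 0 < e -> exists N, forall m n, (N <= m)%N -> (N <= n)%N -> rho (u m) (u n) < e.

Definition converges_wrt (T : Type) (rho : T -> T -> R) (u : nat -> T) (l : T) : Prop :=
  forall e : R, 0 < e -> exists N, forall n, (N <= n)%N -> rho (u n) l < e.

Lemma cauchy_wrt_cvg (u : nat -> R) :
  cauchy_wrt (fun x y => `|x - y|) u -> cvg (u n @[n --> \oo]).
Proof.
move=> cu; apply: cauchy_cvg; apply: cauchy_exP => e e_gt0.
have [N uN] := cu e e_gt0; exists (u N); exists N => //= n Nn.
exact: uN.
Qed.

End Convergence.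

Lemma additive_bounded_linear (R : realType) (f : R -> R) (C : R) :
  (forall s t, f (s + t) = f s + f t) -> (forall t, 0 <= t <= 1 -> `|f t| <= C) ->
  forall t, f t = t * f 1.
Proof.
move=> fD f_le.
have f0 : f 0 = 0 by have := fD 0 0; rewrite addr0; lra.
have fN t : f (- t) = - f t by have := fD t (- t); rewrite subrr f0; lra.
have fMn n t : f (n%:R * t) = n%:R * f t.
  elim: n => [|n IH]; first by rewrite !mul0r f0.
  by rewrite -natr1 !mulrDl !mul1r fD IH.
suff fpos t : 0 <= t -> f t = t * f 1.
  move=> t; have [/fpos//|/ltW t_le0] := leP 0 t.
  by rewrite -[t]opprK fN fpos ?oppr_ge0 //; ring.
move=> t_ge0.
have defect_le s : 0 <= s -> `|f s - s * f 1| <= 2 * C.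
  move=> /truncn_itv/andP[]; set n := Num.truncn s => ns sn.
  have frac01 : 0 <= s - n%:R <= 1 by rewrite -natr1 in sn; apply/andP; split; lra.
  have -> : f s - s * f 1 = f (s - n%:R) - (s - n%:R) * f 1.
    have -> : f s = n%:R * f 1 + f (s - n%:R) by rewrite -fMn -fD mulr1 addrC subrK.
    by ring.
  have := f_le 1; rewrite ler01 lexx => /(_ isT) f1_le.
  have := f_le _ frac01; move: frac01; set u := s - _ => /andP[u_ge0 u_le1] fu_le.
  apply: le_trans (ler_normB _ _) _; rewrite normrM (ger0_norm u_ge0).
  by have := normr_ge0 (f 1); nra.
(* The defect at n t is n times the defect at t, and stays bounded. *)
apply/eqP; rewrite -subr_eq0 -normr_le0; apply/ler_addgt0Pr => e e_gt0.
rewrite add0r leNgt; apply/negP => lt_e.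
have /archi_boundP : 0 <= 2 * C / e.
  by rewrite divr_ge0 ?(ltW e_gt0) // (le_trans _ (defect_le 0 _)).
set n := Num.bound _ => lt_n.
have := defect_le (n%:R * t); rewrite mulr_ge0 // fMn -mulrA -mulrBr normrM normr_nat.
rewrite ltr_pdivrMr // in lt_n.
have : n%:R * e <= n%:R * `|f t - t * f 1| by rewrite ler_wpM2l // ltW.
by move=> ? /(_ isT); lra.
Qed.

Record psd_kernel (R : realFieldType) (Y : Type) := PsdKernel {
  kernel_val :> Y -> Y -> R;
  kernel_pos_def : pos_def kernel_val;
  kernel_sym : forall x y, kernel_val x y = kernel_val y x }.

Section RKHS.
Variables (R : realType) (Y : Type) (K : psd_kernel R Y).
Implicit Types (f g h : Y -> R) (l : seq (R * Y)).

Definition scale_coefs (c : R) l : seq (R * Y) := [seq (c * p.1, p.2) | p <- l].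

Lemma bformC l l' : bform K l l' = bform K l' l.
Proof.
rewrite /bform exchange_big /=; apply: eq_bigr => p _; apply: eq_bigr => q _.
by rewrite (kernel_sym K) (mulrC q.1).
Qed.

Lemma kernel_diag_ge0 y : 0 <= K y y.
Proof. by have := kernel_pos_def K [:: (1, y)]; rewrite /bform !big_seq1 /= !mul1r. Qed.

Lemma bform_catr l l1 l2 : bform K l (l1 ++ l2) = bform K l l1 + bform K l l2.
Proof. by rewrite /bform -big_split /=; apply: eq_bigr => p _; rewrite big_cat. Qed.

Lemma bform_cat l l' :
  bform K (l ++ l') (l ++ l') = bform K l l + bform K l' l' + 2 * bform K l l'.
Proof.
rewrite [LHS]big_cat /= -/(bform K l _) -/(bform K l' _) !bform_catr (bformC l' l).
by ring.
Qed.

Lemma bform_scalel c l l' : bform K (scale_coefs c l) l' = c * bform K l l'.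
Proof.
rewrite /bform big_map mulr_sumr; apply: eq_bigr => p _; rewrite mulr_sumr.
by apply: eq_bigr => q _ /=; rewrite !mulrA.
Qed.

Lemma bform_scaler c l l' : bform K l (scale_coefs c l') = c * bform K l l'.
Proof. by rewrite bformC bform_scalel bformC. Qed.

Definition pairing f l : R := \sum_(p <- l) p.1 * f p.2.

Lemma pairing_cat f l l' : pairing f (l ++ l') = pairing f l + pairing f l'.
Proof. exact: big_cat. Qed.

Lemma pairing_scale f c l : pairing f (scale_coefs c l) = c * pairing f l.
Proof.
by rewrite /pairing big_map mulr_sumr; apply: eq_bigr => p _ /=; rewrite mulrA.
Qed.

Lemma pairingD f g l : pairing (f + g) l = pairing f l + pairing g l.
Proof. by rewrite /pairing -big_split; apply: eq_bigr => p _; rewrite fctE mulrDr. Qed.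

Lemma pairingN f l : pairing (- f) l = - pairing f l.
Proof. by rewrite /pairing -sumrN; apply: eq_bigr => p _; rewrite fctE mulrN. Qed.

Lemma pairingZ c f l : pairing (c *: f) l = c * pairing f l.
Proof.
rewrite /pairing mulr_sumr; apply: eq_bigr => p _.
by rewrite fctE /GRing.scale /= mulrCA.
Qed.

Lemma pairing_cvg (u : nat -> Y -> R) f l :
  (forall y, u n y @[n --> \oo] --> f y) -> pairing (u n) l @[n --> \oo] --> pairing f l.
Proof.
move=> uf; apply: cvg_big => [|p _]; first exact: add_continuous.
exact: cvgM (cvg_cst _) (uf _).
Qed.

(* The squared norm of the reproducing kernel space, as the Legendre transform of
   the quadratic form: |f|^2 = sup_l (2 <f, l> - |l|^2), finite exactly on the space. *)
Definition bounded_by f (C : R) : Prop := forall l, 2 * pairing f l - bform K l l <= C.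
Definition finite_norm f : Prop := exists C, bounded_by f C.
Definition sqnorm f : R := sup (range (fun l => 2 * pairing f l - bform K l l)).

Lemma sqnorm_le f C : bounded_by f C -> sqnorm f <= C.
Proof.
move=> fC; apply: ge_sup; last by move=> _ [l _ <-].
by exists (2 * pairing f [::] - bform K [::] [::]); exists [::].
Qed.

Lemma sqnorm_bound f : finite_norm f -> bounded_by f (sqnorm f).
Proof.
move=> [C fC] l; apply: ub_le_sup; last by exists l.
by exists C => _ [l' _ <-].
Qed.

Lemma sqnorm_ge0 f : finite_norm f -> 0 <= sqnorm f.
Proof.
by move=> /sqnorm_bound/(_ [::]); rewrite /pairing /bform !big_nil mulr0 subrr.
Qed.

Lemma bounded_by_half f C l : bounded_by f C -> 2 * pairing f l - bform K l l / 2 <= 2 * C.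
Proof.
by move=> /(_ (scale_coefs 2^-1 l)); rewrite pairing_scale bform_scalel bform_scaler; lra.
Qed.

Lemma bounded_byD f g C D : bounded_by f C -> bounded_by g D -> bounded_by (f + g) (2 * C + 2 * D).
Proof.
move=> fC gD l; rewrite pairingD.
by have := bounded_by_half l fC; have := bounded_by_half l gD; lra.
Qed.

Lemma bounded_by0 : bounded_by 0 0.
Proof.
move=> l; rewrite /pairing big1 => [|p _]; last by rewrite mulr0.
by rewrite mulr0 sub0r oppr_le0 kernel_pos_def.
Qed.

Lemma bounded_byZ c f C : bounded_by f C -> bounded_by (c *: f) (c ^+ 2 * C).
Proof.
move=> fC; have [->|c_neq0] := eqVneq c 0.
  by rewrite scale0r expr0n mul0r; exact: bounded_by0.
move=> l; have := ler_wpM2l (sqr_ge0 c) (fC (scale_coefs c^-1 l)).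
rewrite pairing_scale bform_scalel bform_scaler pairingZ; congr (_ <= _).
by field.
Qed.

Lemma finite_normD f g : finite_norm f -> finite_norm g -> finite_norm (f + g).
Proof. by move=> [C fC] [D gD]; exists (2 * C + 2 * D); exact: bounded_byD. Qed.

Lemma finite_normZ c f : finite_norm f -> finite_norm (c *: f).
Proof. by move=> [C fC]; exists (c ^+ 2 * C); exact: bounded_byZ. Qed.

Lemma finite_normB f g : finite_norm f -> finite_norm g -> finite_norm (f - g).
Proof. by move=> ff fg; rewrite -scaleN1r; apply: finite_normD => //; exact: finite_normZ. Qed.

Lemma finite_norm0 : finite_norm 0.
Proof. by exists 0; exact: bounded_by0. Qed.

Lemma sqnorm0 : sqnorm 0 = 0.
Proof. by apply: le_anti; rewrite sqnorm_ge0 ?(sqnorm_le bounded_by0) //; exact: finite_norm0. Qed.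

Lemma sqnormZ c f : finite_norm f -> sqnorm (c *: f) = c ^+ 2 * sqnorm f.
Proof.
move=> ff; apply: le_anti; rewrite sqnorm_le /=; last exact/bounded_byZ/sqnorm_bound.
have [->|c_neq0] := eqVneq c 0; first by rewrite scale0r sqnorm0 expr0n mul0r.
rewrite -ler_pdivlMl ?exprn_even_gt0 // -exprVn; apply: sqnorm_le.
rewrite -[X in bounded_by X]scale1r -(mulVf c_neq0) -scalerA.
exact/bounded_byZ/sqnorm_bound/finite_normZ.
Qed.

Lemma parallelogram_le f g : finite_norm f -> finite_norm g ->
  sqnorm (f + g) + sqnorm (f - g) <= 2 * sqnorm f + 2 * sqnorm g.
Proof.
move=> ff fg; rewrite -lerBrDr; apply: sqnorm_le => l; rewrite lerBrDr addrC -lerBrDr.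
apply: sqnorm_le => l'; rewrite lerBrDr !pairingD pairingN.
have := bounded_by_half (l ++ l') (sqnorm_bound ff).
have := bounded_by_half (l ++ scale_coefs (-1) l') (sqnorm_bound fg).
rewrite !pairing_cat !bform_cat pairing_scale bform_scalel !bform_scaler; lra.
Qed.

(* The converse inequality is the direct one at f + g and f - g. *)
Lemma parallelogram f g : finite_norm f -> finite_norm g ->
  sqnorm (f + g) + sqnorm (f - g) = 2 * sqnorm f + 2 * sqnorm g.
Proof.
move=> ff fg; apply: le_anti; rewrite parallelogram_le //=.
have := parallelogram_le (finite_normD ff fg) (finite_normB ff fg).
have -> : f + g + (f - g) = 2 *: f by rewrite addrACA subrr addr0 scaler_nat.
have -> : f + g - (f - g) = 2 *: g by rewrite opprB addrC addrA subrK scaler_nat.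
by rewrite !sqnormZ //; lra.
Qed.

Definition inner f g : R := (sqnorm (f + g) - sqnorm f - sqnorm g) / 2.

Lemma innerC f g : inner f g = inner g f.
Proof. by rewrite /inner (addrC f g); lra. Qed.

Lemma inner_self f : finite_norm f -> inner f f = sqnorm f.
Proof. by move=> ff; rewrite /inner -mulr2n -scaler_nat sqnormZ //; lra. Qed.

Lemma innerDl f g h : finite_norm f -> finite_norm g -> finite_norm h ->
  inner (f + g) h = inner f h + inner g h.
Proof.
move=> ff fg fh.
have := parallelogram (finite_normD ff fg) fh.
have := parallelogram (finite_normD ff fh) fg.
have := parallelogram ff (finite_normB fg fh).
have := parallelogram fg fh.
rewrite /inner (addrA f g (- h)) opprB (addrA f h (- g)) (addrAC f h g) => *; lra.
Qed.

Lemma normr_inner_le f g : finite_norm f -> finite_norm g ->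
  `|inner f g| <= (sqnorm f + sqnorm g) / 2.
Proof.
move=> ff fg; have := parallelogram ff fg.
have := sqnorm_ge0 (finite_normB ff fg); have := sqnorm_ge0 (finite_normD ff fg).
by rewrite /inner ler_norml => *; apply/andP; split; lra.
Qed.

Lemma innerZl c f g : finite_norm f -> finite_norm g -> inner (c *: f) g = c * inner f g.
Proof.
move=> ff fg; rewrite -[f in RHS]scale1r.
apply: (@additive_bounded_linear R (fun t => inner (t *: f) g) ((sqnorm f + sqnorm g) / 2)).
  by move=> s t; rewrite scalerDl innerDl //; exact: finite_normZ.
move=> t /andP[t_ge0 t_le1]; apply: le_trans (normr_inner_le (finite_normZ t ff) fg) _.
by rewrite ler_pM2r ?invr_gt0 // lerD2r sqnormZ // ler_piMl ?exprn_ile1 // sqnorm_ge0.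
Qed.

Lemma pairing_sqnorm f l : finite_norm f -> pairing f l ^+ 2 <= sqnorm f * bform K l l.
Proof.
move=> ff; have q_ge0 := kernel_pos_def K l; have s_ge0 := sqnorm_ge0 ff.
set a := pairing f l; set q := bform K l l in q_ge0 *.
have quad t : 2 * (t * a) - t ^+ 2 * q <= sqnorm f.
  have := sqnorm_bound ff (scale_coefs t l).
  by rewrite pairing_scale bform_scalel bform_scaler [t * (t * _)]mulrA -expr2.
have [q0|q_neq0] := eqVneq q 0; last first.
  have q_gt0 : 0 < q by rewrite lt_neqAle eq_sym q_neq0.
  rewrite -ler_pdivrMr //; suff -> : a ^+ 2 / q = 2 * (a / q * a) - (a / q) ^+ 2 * q by [].
  by field.
have [->|a_neq0] := eqVneq a 0; first by rewrite expr0n mulr_ge0.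
have := quad ((sqnorm f + 1) / a).
by rewrite q0 mulr0 subr0 divfK // => ?; exfalso; lra.
Qed.

Lemma eval_sqnorm f y : finite_norm f -> f y ^+ 2 <= sqnorm f * K y y.
Proof.
by move=> /(pairing_sqnorm [:: (1, y)]); rewrite /pairing /bform !big_seq1 /= !mul1r.
Qed.

Lemma sqnorm_le0 f : finite_norm f -> sqnorm f <= 0 -> f = 0.
Proof.
move=> ff f_le0; apply/funext => y; apply/eqP; rewrite -sqrf_eq0 eq_le sqr_ge0 andbT.
by apply: le_trans (eval_sqnorm y ff) _; rewrite mulr_le0_ge0 // kernel_diag_ge0.
Qed.

Definition kernel_comb l : Y -> R := fun y => \sum_(p <- l) p.1 * K p.2 y.

Lemma pairing_kernel_comb l l' : pairing (kernel_comb l) l' = bform K l l'.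
Proof.
rewrite /pairing bformC /bform; apply: eq_bigr => p _; rewrite mulr_sumr.
by apply: eq_bigr => q _; rewrite (kernel_sym K) mulrA.
Qed.

Lemma kernel_comb_bounded l : bounded_by (kernel_comb l) (bform K l l).
Proof.
move=> l'; rewrite pairing_kernel_comb.
have := kernel_pos_def K (l ++ scale_coefs (-1) l').
by rewrite bform_cat bform_scalel !bform_scaler; lra.
Qed.

Lemma kernel_comb_finite l : finite_norm (kernel_comb l).
Proof. by exists (bform K l l); exact: kernel_comb_bounded. Qed.

Lemma sqnorm_kernel_comb l : sqnorm (kernel_comb l) = bform K l l.
Proof.
apply: le_anti; rewrite sqnorm_le /=; last exact: kernel_comb_bounded.
by have := sqnorm_bound (kernel_comb_finite l) l; rewrite pairing_kernel_comb; lra.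
Qed.

Let sqdist f g := sqnorm (f - g).

Lemma sqnorm_pointwise_cvg (u : nat -> Y -> R) y : (forall n, finite_norm (u n)) ->
  cauchy_wrt sqdist u -> cvg (u n y @[n --> \oo]).
Proof.
move=> fu cu; apply: cauchy_wrt_cvg => e e_gt0.
have Kyy : 0 < K y y + 1 by rewrite ltr_wpDl // kernel_diag_ge0.
have [|N uN] := cu (e ^+ 2 / (K y y + 1)); first by rewrite divr_gt0 ?exprn_gt0.
exists N => m n Nm Nn; have fmn := finite_normB (fu m) (fu n).
rewrite -ltr_sqr ?nnegrE ?(ltW e_gt0) // -normrX ger0_norm ?sqr_ge0 //.
apply: le_lt_trans (eval_sqnorm y fmn) _.
have := uN m n Nm Nn; rewrite /sqdist ltr_pdivlMr //; apply: le_lt_trans.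
by rewrite ler_wpM2l ?sqnorm_ge0 // lerDl.
Qed.

Lemma sqnorm_complete (u : nat -> Y -> R) : (forall n, finite_norm (u n)) ->
  cauchy_wrt sqdist u -> exists2 f, finite_norm f & converges_wrt sqdist u f.
Proof.
move=> fu cu; pose f y := lim (u n y @[n --> \oo]).
have uf y : u n y @[n --> \oo] --> f y by exact: sqnorm_pointwise_cvg.
have tail e : 0 < e -> exists N, forall n, (N <= n)%N -> bounded_by (u n - f) e.
  move=> /cu[N uN]; exists N => n Nn l.
  have lim_l : 2 * pairing (u n - u m) l - bform K l l @[m --> \oo] -->
      2 * pairing (u n - f) l - bform K l l.
    apply: cvgB (cvg_cst _); apply: cvgM (cvg_cst _) _; apply: pairing_cvg => y.
    exact: cvgB (cvg_cst _) (uf y).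
  apply: (cvgr_to_le lim_l); exists N => // m /= Nm.
  exact: le_trans (sqnorm_bound (finite_normB (fu n) (fu m)) l) (ltW (uN n m Nn Nm)).
exists f.
  have [N /(_ N (leqnn N)) tailN] := tail 1 ltr01.
  by rewrite -[f](subKr (u N)); apply: finite_normB => //; exists 1.
move=> e e_gt0; have [|N uN] := tail (e / 2); first by rewrite divr_gt0.
by exists N => n /uN/sqnorm_le; rewrite /sqdist; lra.
Qed.

Lemma bounded_by_comp (r : Y -> Y) f C : (forall x y, K (r x) (r y) = K x y) ->
  bounded_by f C -> bounded_by (f \o r) C.
Proof.
move=> Kr fC l; have := fC [seq (p.1, r p.2) | p <- l].
rewrite /pairing /bform !big_map; congr (_ - _ <= _); apply: eq_bigr => p _.
by rewrite big_map; apply: eq_bigr => q _ /=; rewrite Kr.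
Qed.

Section Composition.
Variables r r' : Y -> Y.
Hypotheses (r'K : cancel r' r) (Kr : forall x y, K (r x) (r y) = K x y).

Lemma finite_norm_comp f : finite_norm f -> finite_norm (f \o r).
Proof. by move=> [C fC]; exists C; exact: bounded_by_comp. Qed.

Lemma sqnorm_comp f : finite_norm f -> sqnorm (f \o r) = sqnorm f.
Proof.
move=> ff; have Kr' x y : K (r' x) (r' y) = K x y by rewrite -Kr !r'K.
apply: le_anti; rewrite sqnorm_le /=; last exact/bounded_by_comp/sqnorm_bound.
have {1}-> : f = f \o r \o r' by apply/funext => y /=; rewrite r'K.
exact/sqnorm_le/bounded_by_comp/sqnorm_bound/finite_norm_comp.
Qed.

Lemma inner_comp f g : finite_norm f -> finite_norm g -> inner (f \o r) (g \o r) = inner f g.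
Proof.
by move=> ff fg; rewrite /inner !sqnorm_comp // -(sqnorm_comp (finite_normD ff fg)).
Qed.

End Composition.

End RKHS.

Section ComplexRKHS.
Variables (R : realType) (Y : Type) (K : psd_kernel R Y).
Local Notation Re := (@complex.Re R).
Local Notation Im := (@complex.Im R).
Local Notation finite := (finite_norm K).

Definition complex_finite_norm : {pred Y -> R[i]} :=
  fun f => `[< finite (Re \o f) /\ finite (Im \o f) >].

Lemma Re_comp_linear (a : R[i]) (f g : Y -> R[i]) :
  Re \o (a *: f + g) = Re a *: (Re \o f) - Im a *: (Im \o f) + (Re \o g).
Proof.
apply/funext => y; rewrite !fctE /= /GRing.scale /=.
by case: a (f y) (g y) => [? ?] [? ?] [? ?].
Qed.

Lemma Im_comp_linear (a : R[i]) (f g : Y -> R[i]) :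
  Im \o (a *: f + g) = Re a *: (Im \o f) + Im a *: (Re \o f) + (Im \o g).
Proof.
apply/funext => y; rewrite !fctE /= /GRing.scale /=.
by case: a (f y) (g y) => [? ?] [? ?] [? ?].
Qed.

Lemma complex_finite_norm_submod : submod_closed complex_finite_norm.
Proof.
split; first by apply/asboolP; split; exact: finite_norm0.
move=> a f g /asboolP[fr fi] /asboolP[gr gi]; apply/asboolP.
rewrite Re_comp_linear Im_comp_linear; split; apply: finite_normD => //.
  by apply: finite_normB; exact: finite_normZ.
by apply: finite_normD; exact: finite_normZ.
Qed.

HB.instance Definition _ :=
  GRing.isSubmodClosed.Build _ _ complex_finite_norm complex_finite_norm_submod.

Record rkhs := Rkhs { rkhs_fun : Y -> R[i]; rkhs_funP : rkhs_fun \in complex_finite_norm }.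
HB.instance Definition _ := [isSub for rkhs_fun].
HB.instance Definition _ := [Choice of rkhs by <:].
HB.instance Definition _ := [SubChoice_isSubLmodule of rkhs by <:].

Implicit Types (u v w : rkhs).

Definition re_part v : Y -> R := Re \o rkhs_fun v.
Definition im_part v : Y -> R := Im \o rkhs_fun v.

Lemma re_part_finite v : finite (re_part v).
Proof. by have /asboolP[] := rkhs_funP v. Qed.

Lemma im_part_finite v : finite (im_part v).
Proof. by have /asboolP[] := rkhs_funP v. Qed.

Lemma re_part_linear a u v :
  re_part (a *: u + v) = Re a *: re_part u - Im a *: im_part u + re_part v.
Proof. exact: Re_comp_linear. Qed.

Lemma im_part_linear a u v :
  im_part (a *: u + v) = Re a *: im_part u + Im a *: re_part u + im_part v.
Proof. exact: Im_comp_linear. Qed.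

Lemma re_partB u v : re_part (u - v) = re_part u - re_part v.
Proof.
by rewrite addrC -scaleN1r re_part_linear /= oppr0 scale0r subr0 scaleN1r addrC.
Qed.

Lemma im_partB u v : im_part (u - v) = im_part u - im_part v.
Proof.
by rewrite addrC -scaleN1r im_part_linear /= oppr0 scale0r addr0 scaleN1r addrC.
Qed.

Lemma rkhs_eq u v : re_part u = re_part v -> im_part u = im_part v -> u = v.
Proof.
move=> /(congr1 (@^~ _)) reE /(congr1 (@^~ _)) imE; apply: val_inj; apply/funext => y /=.
by apply/eqP; rewrite eq_complex; apply/andP; split; apply/eqP; [exact: reE|exact: imE].
Qed.

Lemma rkhs_of_parts (f g : Y -> R) : finite f -> finite g ->
  exists v, re_part v = f /\ im_part v = g.
Proof.
move=> ff fg; have fgP : (fun y => Complex (f y) (g y)) \in complex_finite_norm.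
  exact/asboolP.
by exists (Rkhs fgP).
Qed.

Definition rkhs_ip u v : R[i] :=
  Complex (inner K (re_part u) (re_part v) + inner K (im_part u) (im_part v))
          (inner K (im_part u) (re_part v) - inner K (re_part u) (im_part v)).

Lemma rkhs_ip_linear a u v w : rkhs_ip (a *: u + v) w = a * rkhs_ip u w + rkhs_ip v w.
Proof.
have [refin imfin] := (re_part_finite, im_part_finite).
have inner_lin (s t : R) f1 f2 f3 h : finite f1 -> finite f2 -> finite f3 -> finite h ->
    inner K (s *: f1 + t *: f2 + f3) h = s * inner K f1 h + t * inner K f2 h + inner K f3 h.
  move=> ? ? ? ?; rewrite !innerDl ?innerZl //; try exact: finite_normZ.
  by apply: finite_normD; exact: finite_normZ.
rewrite /rkhs_ip re_part_linear im_part_linear -scaleNr !inner_lin //.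
by case: a => a b /=; apply/eqP; rewrite eq_complex /=; apply/andP; split; apply/eqP; ring.
Qed.

Definition rkhs_sqnorm v : R := sqnorm K (re_part v) + sqnorm K (im_part v).

Lemma rkhs_ip_self v : rkhs_ip v v = (rkhs_sqnorm v)%:C%C.
Proof.
rewrite /rkhs_ip innerC subrr !inner_self //; [exact: im_part_finite|exact: re_part_finite].
Qed.

Lemma rkhs_sqnorm_ge0 v : 0 <= rkhs_sqnorm v.
Proof. by rewrite addr_ge0 ?sqnorm_ge0 //; [exact: re_part_finite|exact: im_part_finite]. Qed.

Lemma rkhs_sqnorm_eq0 v : rkhs_sqnorm v = 0 -> v = 0.
Proof.
have [r_ge0 i_ge0] := (sqnorm_ge0 (re_part_finite v), sqnorm_ge0 (im_part_finite v)).
rewrite /rkhs_sqnorm => v0.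
by apply: rkhs_eq; apply: (@sqnorm_le0 _ _ K);
  [exact: re_part_finite|lra|exact: im_part_finite|lra].
Qed.

Lemma hnorm_rkhs v : hnorm rkhs_ip v = Num.sqrt (rkhs_sqnorm v).
Proof. by rewrite /hnorm rkhs_ip_self. Qed.

Lemma hnorm_rkhs_lt v (e : R) : 0 < e -> (hnorm rkhs_ip v < e) = (rkhs_sqnorm v < e ^+ 2).
Proof.
move=> e_gt0; rewrite hnorm_rkhs -[X in _ < X]ger0_norm ?(ltW e_gt0) // -sqrtr_sqr.
by rewrite ltr_sqrt // exprn_gt0.
Qed.

Lemma rkhs_complete (u : nat -> rkhs) : cauchy_wrt (fun v w => hnorm rkhs_ip (v - w)) u ->
  exists l, converges_wrt (fun v w => hnorm rkhs_ip (v - w)) u l.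
Proof.
move=> cu; have part_cauchy (part : rkhs -> Y -> R) :
    (forall v, sqnorm K (part v) <= rkhs_sqnorm v) ->
    (forall v w, part (v - w) = part v - part w) ->
    cauchy_wrt (fun f g => sqnorm K (f - g)) (part \o u).
  move=> part_le partB e e_gt0; have [|N uN] := cu (Num.sqrt e); first by rewrite sqrtr_gt0.
  exists N => m n Nm Nn; have := uN m n Nm Nn.
  rewrite hnorm_rkhs_lt ?sqrtr_gt0 // sqr_sqrtr ?(ltW e_gt0) // /= -partB.
  exact: le_lt_trans.
have [||f ff fP] := @sqnorm_complete _ _ K (re_part \o u).
- by move=> n; exact: re_part_finite.
- apply: part_cauchy => [v|]; last exact: re_partB.
  by rewrite lerDl sqnorm_ge0 //; exact: im_part_finite.
have [||g fg gP] := @sqnorm_complete _ _ K (im_part \o u).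
- by move=> n; exact: im_part_finite.
- apply: part_cauchy => [v|]; last exact: im_partB.
  by rewrite lerDr sqnorm_ge0 //; exact: re_part_finite.
have [l [lf lg]] := rkhs_of_parts ff fg; exists l => e e_gt0.
have e2_gt0 : 0 < e ^+ 2 / 2 by rewrite divr_gt0 ?exprn_gt0.
have [n1 fn1] := fP _ e2_gt0; have [n2 gn2] := gP _ e2_gt0.
exists (maxn n1 n2) => n; rewrite geq_max => /andP[/fn1 fn /gn2 gn].
by rewrite hnorm_rkhs_lt // /rkhs_sqnorm re_partB im_partB lf lg; move: fn gn => /=; lra.
Qed.

Lemma rkhs_hilbert : is_hilbert rkhs_ip.
Proof.
split; [exact: rkhs_ip_linear| | | |exact: rkhs_complete].
- move=> u v; rewrite /rkhs_ip [inner K (im_part u) (re_part v)]innerC.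
  rewrite [inner K (re_part u) (im_part v)]innerC [inner K (im_part u) _]innerC.
  by rewrite [inner K (re_part u) _]innerC /= opprB.
- by move=> v; rewrite rkhs_ip_self ler0c rkhs_sqnorm_ge0.
- by move=> v; rewrite rkhs_ip_self => /complexI/rkhs_sqnorm_eq0.
Qed.

End ComplexRKHS.

Section InvariantKernel.
Variables (R : realType) (H : Type) (mul : H -> H -> H) (one : H) (inv : H -> H).
Hypothesis H_group : is_group mul one inv.
Variables (Y : Type) (K : psd_kernel R Y) (rho : H -> Y -> Y).
Hypotheses (rho1 : forall y, rho one y = y)
  (rhoM : forall g h y, rho (mul g h) y = rho g (rho h y))
  (rhoK : forall g x y, K (rho g x) (rho g y) = K x y).

Lemma rho_invK g : cancel (rho (inv g)) (rho g).
Proof. by case: H_group => _ _ invP y; rewrite -rhoM (invP g).2. Qed.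

Lemma rhoKinv g : cancel (rho g) (rho (inv g)).
Proof. by case: H_group => _ _ invP y; rewrite -rhoM (invP g).1. Qed.

Lemma translate_finite g (v : rkhs K) : rkhs_fun v \o rho (inv g) \in complex_finite_norm K.
Proof.
apply/asboolP; split.
  exact: (finite_norm_comp (rhoK (inv g)) (re_part_finite v)).
exact: (finite_norm_comp (rhoK (inv g)) (im_part_finite v)).
Qed.

Definition translate g (v : rkhs K) : rkhs K := Rkhs (translate_finite g v).

Lemma translate_unitary : unitary_rep (@rkhs_ip R Y K) mul one translate.
Proof.
split=> [g a u v|g u v|v|g h v].
- exact: val_inj.
- have inner_translate := inner_comp (rhoKinv g) (rhoK (inv g)).
  have [refin imfin] := (@re_part_finite _ _ K, @im_part_finite _ _ K).
  have re_translate w : re_part (translate g w) = re_part w \o rho (inv g) by [].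
  have im_translate w : im_part (translate g w) = im_part w \o rho (inv g) by [].
  by rewrite /rkhs_ip !re_translate !im_translate !inner_translate.
- by apply: val_inj; apply/funext => y /=; rewrite -[X in rkhs_fun v X]rho1 rho_invK.
- apply: val_inj; apply/funext => y /=; congr (rkhs_fun v _).
  by apply: (can_inj (rhoKinv (mul g h))); rewrite rho_invK rhoM !rho_invK.
Qed.

Lemma translate_kernel_almost_invariant :
  (forall n (Q : 'I_n -> H) (e : R), 0 < e ->
     exists y, K y y = 1 /\ forall i, 1 - e < K (rho (Q i) y) y) ->
  almost_invariant_vectors (@rkhs_ip R Y K) translate.
Proof.
move=> Kai n Q e e_gt0; have [|y [Kyy Qy]] := Kai n Q (e ^+ 2 / 2).
  by rewrite divr_gt0 ?exprn_gt0.
have [v [vre vim]] := rkhs_of_parts (kernel_comb_finite K [:: (1, y)]) (finite_norm0 K).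
exists v; split.
  rewrite hnorm_rkhs /rkhs_sqnorm vre vim sqnorm0 sqnorm_kernel_comb.
  by rewrite /bform !big_seq1 /= Kyy !mulr1 addr0 sqrtr1.
move=> i; rewrite hnorm_rkhs_lt // /rkhs_sqnorm re_partB im_partB vim subr0.
have -> : im_part (translate (Q i) v) = 0 by rewrite -[LHS]/(im_part v \o _) vim.
have -> : re_part (translate (Q i) v) - re_part v = kernel_comb K [:: (1, rho (Q i) y); (-1, y)].
  rewrite -[re_part (translate _ _)]/(re_part v \o _) vre; apply/funext => z.
  by rewrite !fctE /kernel_comb !big_cons !big_nil /= -{1}(rhoK (Q i)) rho_invK; ring.
rewrite sqnorm0 addr0 sqnorm_kernel_comb /bform !big_cons !big_nil /= rhoK Kyy.
by rewrite (kernel_sym K y); have := Qy i; lra.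
Qed.

Lemma property_T_invariant_fun : property_T R mul one inv ->
  (forall n (Q : 'I_n -> H) (e : R), 0 < e ->
     exists y, K y y = 1 /\ forall i, 1 - e < K (rho (Q i) y) y) ->
  exists f : Y -> R, [/\ finite_norm K f, forall g y, f (rho g y) = f y & exists y, f y != 0].
Proof.
move=> H_propT /translate_kernel_almost_invariant ai.
have [v [v_neq0 v_inv]] := H_propT _ _ _ (rkhs_hilbert K) translate_unitary ai.
have fun_inv g y : rkhs_fun v (rho g y) = rkhs_fun v y.
  by have := congr1 (fun w => rkhs_fun w (rho g y)) (v_inv g); rewrite /= rhoKinv.
have nonzero (f : Y -> R) : f <> 0 -> exists y, f y != 0.
  move=> f_neq0; apply: contrapT => no; apply: f_neq0; apply/funext => y.
  by apply/eqP/negPn/negP => fy; apply: no; exists y.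
have [re0|/nonzero re_neq0] := pselect (re_part v = 0); last first.
  by exists (re_part v); split=> // [|g y]; [exact: re_part_finite|rewrite /re_part /= fun_inv].
exists (im_part v); split=> [|g y|]; [exact: im_part_finite|by rewrite /im_part /= fun_inv|].
by apply: nonzero => im0; apply: v_neq0; apply: rkhs_eq.
Qed.

End InvariantKernel.

(** * Property (T) bounds orbits *)

Definition exp_kernel (R : realType) (Y : Type) (D : Y -> Y -> R) (t : R) (x y : Y) : R :=
  expR (- (t * D x y)).

Section BoundedOrbit.
Variables (R : realType) (H : Type) (mul : H -> H -> H) (one : H) (inv : H -> H).
Hypotheses (H_group : is_group mul one inv) (H_propT : property_T R mul one inv).
Variable D : H -> H -> R.
Hypotheses (D_ge0 : forall g h, 0 <= D g h) (Dxx : forall g, D g g = 0)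
  (DC : forall g h, D g h = D h g) (D_triangle : forall a b c, D a c <= D a b + D b c)
  (D_mul : forall k g h, D (mul k g) (mul k h) = D g h)
  (D_exp : forall t : R, 0 <= t -> pos_def (exp_kernel D t)).

Lemma exp_kernelC t g h : exp_kernel D t g h = exp_kernel D t h g.
Proof. by rewrite /exp_kernel DC. Qed.

Lemma exp_kernel_diag t g : exp_kernel D t g g = 1.
Proof. by rewrite /exp_kernel Dxx mulr0 oppr0 expR0. Qed.

Lemma exp_kernel_sum_small (t : R) (s : seq H) (e : R) : 0 < t -> 0 < e ->
  exists C : R, forall g, C <= D g one -> \sum_(h <- s) exp_kernel D t g h <= e.
Proof.
move=> t_gt0; elim: s e => [|h s IH] e e_gt0; first by exists 0 => g _; rewrite big_nil ltW.
have e2_gt0 : 0 < e / 2 by rewrite divr_gt0.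
have [C C_far] := IH _ e2_gt0; exists (Num.max C (D h one + (e / 2)^-1 / t)) => g.
rewrite ge_max => /andP[/C_far sum_s g_far]; rewrite big_cons.
suff : exp_kernel D t g h <= e / 2 by lra.
have : (e / 2)^-1 <= t * D g h.
  by rewrite -ler_pdivrMl // mulrC; have := D_triangle g h one; lra.
rewrite /exp_kernel expRN; set u := t * _ => le_u.
rewrite -[leRHS]invrK lef_pV2 ?posrE ?expR_gt0 ?invr_gt0 //.
by apply: le_trans le_u _; apply: le_trans (expR_ge1Dx u); rewrite lerDr.
Qed.

Lemma unbounded_spread (t : R) (n : nat) : 0 < t -> (forall C, exists g, C < D g one) ->
  exists2 s : seq H, size s = n &
    \sum_(g <- s) \sum_(h <- s) exp_kernel D t g h <= 2 * n%:R.
Proof.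
move=> t_gt0 unbounded; elim: n => [|n [s size_s sum_s]].
  by exists [::]; rewrite // big_nil mulr0.
have [|C C_far] := @exp_kernel_sum_small t s 2^-1 t_gt0; first by rewrite invr_gt0.
have [g /ltW/C_far sum_g] := unbounded C.
exists (g :: s); first by rewrite /= size_s.
rewrite big_cons big_cons exp_kernel_diag.
under [X in _ + X <= _]eq_bigr do rewrite big_cons exp_kernelC.
by rewrite big_split /= -[n.+1]addn1 natrD; lra.
Qed.

Let level n := n.+1%:R^-1 : R.

Lemma level_kernel_pos_def : pos_def (direct_sum_kernel (fun n => exp_kernel D (level n))).
Proof. by apply: pos_def_direct_sum => n; apply: D_exp; rewrite invr_ge0. Qed.

Lemma level_kernel_sym x y : direct_sum_kernel (fun n => exp_kernel D (level n)) x y =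
  direct_sum_kernel (fun n => exp_kernel D (level n)) y x.
Proof. by rewrite /direct_sum_kernel eq_sym; case: eqP => // ->; exact: exp_kernelC. Qed.

Definition level_kernel : psd_kernel R (H * nat) :=
  PsdKernel level_kernel_pos_def level_kernel_sym.

Lemma level_kernelE n g h : level_kernel (g, n) (h, n) = exp_kernel D (level n) g h.
Proof. by rewrite /= /direct_sum_kernel eqxx. Qed.

Lemma level_kernel_almost_invariant n (Q : 'I_n -> H) (e : R) : 0 < e ->
  exists y, level_kernel y y = 1 /\ forall i, 1 - e < level_kernel (mul (Q i) y.1, y.2) y.
Proof.
move=> e_gt0; have [_ m1 _] := H_group; pose S := \sum_i D (Q i) one.
have /archi_boundP : 0 <= S / e by rewrite divr_ge0 ?sumr_ge0 // ltW.
set k := Num.bound _ => S_lt; exists (one, k); rewrite level_kernelE exp_kernel_diag.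
split=> // i; rewrite level_kernelE (m1 (Q i)).2.
apply: lt_le_trans (expR_ge1Dx _); rewrite ltrD2l ltrN2 mulrC ltr_pdivrMr // mulrC.
rewrite ltr_pdivrMr // in S_lt; apply: (@le_lt_trans _ _ S).
  by rewrite /S (bigD1 i) //= lerDl sumr_ge0.
by apply: lt_le_trans S_lt _; rewrite ler_pM2r // ler_nat.
Qed.

(* A spread out family of size n tests the norm of f from below by a multiple of n. *)
Lemma sqnorm_constant_ge (f : H * nat -> R) (k : nat) (c : R) n :
  finite_norm level_kernel f -> (forall g, f (g, k) = c) -> (forall C, exists g, C < D g one) ->
  n%:R * c ^+ 2 <= 2 * sqnorm level_kernel f.
Proof.
move=> ff f_const unbounded.
have [|s size_s sum_s] := unbounded_spread n (_ : 0 < level k) unbounded.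
  by rewrite invr_gt0.
have := sqnorm_bound ff [seq (c / 2, (g, k)) | g <- s].
have -> : pairing f [seq (c / 2, (g, k)) | g <- s] = c ^+ 2 / 2 * n%:R.
  rewrite /pairing big_map /=; under eq_bigr do rewrite f_const.
  by rewrite big_const_seq count_predT iter_addr_0 size_s -mulr_natr; field.
have -> : bform level_kernel [seq (c / 2, (g, k)) | g <- s] [seq (c / 2, (g, k)) | g <- s] =
    (c / 2) ^+ 2 * \sum_(g <- s) \sum_(h <- s) exp_kernel D (level k) g h.
  rewrite /bform big_map mulr_sumr; apply: eq_bigr => g _; rewrite big_map mulr_sumr.
  by apply: eq_bigr => h _; rewrite level_kernelE -expr2.
have := ler_wpM2l (sqr_ge0 (c / 2)) sum_s.
have -> : (c / 2) ^+ 2 * (2 * n%:R) = n%:R * c ^+ 2 / 2 by field.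
by rewrite (mulrC n%:R); lra.
Qed.

Lemma property_T_bounded : exists C : R, forall g, D g one <= C.
Proof.
have [mA m1 mV] := H_group; pose rho g (x : H * nat) := (mul g x.1, x.2).
have [||||f [ff f_inv [[h k] f_neq0]]] :=
    @property_T_invariant_fun R H mul one inv H_group _ level_kernel rho _ _ _ H_propT _.
- by case=> g n; rewrite /rho /= (m1 g).1.
- by move=> g g' [x n]; rewrite /rho /= mA.
- by move=> g [x m] [y n]; rewrite /= /direct_sum_kernel /exp_kernel /= D_mul.
- exact: level_kernel_almost_invariant.
have f_const g : f (g, k) = f (h, k).
  by rewrite -(f_inv (mul h (inv g)) (g, k)) /rho /= -mA (mV g).1 (m1 h).2.
apply: contrapT => bounded; have unbounded C : exists g, C < D g one.
  apply: contrapT => no; apply: bounded; exists C => g.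
  by rewrite leNgt; apply/negP => lt_C; apply: no; exists g.
set c := f (h, k) in f_neq0 f_const.
have c2_gt0 : 0 < c ^+ 2 by rewrite exprn_even_gt0.
have /archi_boundP : 0 <= 2 * sqnorm level_kernel f / c ^+ 2.
  by rewrite divr_ge0 ?(ltW c2_gt0) // mulr_ge0 ?sqnorm_ge0.
by rewrite ltr_pdivrMr // ltNge (sqnorm_constant_ge _ ff f_const).
Qed.

End BoundedOrbit.

Lemma property_T_bounded_orbit (R : realType) (H : Type) (mul : H -> H -> H) (one : H)
    (inv : H -> H) (Y : Type) (D : Y -> Y -> R) (rho : H -> Y -> Y) (y0 : Y) :
  is_group mul one inv -> property_T R mul one inv -> is_metric D ->
  (forall t, 0 <= t -> pos_def (exp_kernel D t)) -> (forall y, rho one y = y) ->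
  (forall g h y, rho (mul g h) y = rho g (rho h y)) ->
  (forall g x y, D (rho g x) (rho g y) = D x y) ->
  exists C, forall g, D y0 (rho g y0) <= C.
Proof.
move=> H_group H_propT [D_ge0 D_eq0 DC D_triangle] D_exp rho1 rhoM D_rho.
have [||||||C orbit_le] :=
    property_T_bounded H_group H_propT (D := fun g h => D (rho g y0) (rho h y0)).
- by move=> g h; exact: D_ge0.
- by move=> g; apply/D_eq0.
- by move=> g h; exact: DC.
- by move=> a b c; exact: D_triangle.
- by move=> k g h; rewrite !rhoM D_rho.
- by move=> t /D_exp; exact: (pos_def_comp (fun g => rho g y0)).
by exists C => g; have := orbit_le g; rewrite rho1 DC.
Qed.

(** * Median algebras *)

Section MedianAlgebra.
Variables (X : Type) (mu : X -> X -> X -> X).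
Hypothesis mu_median : median_algebra mu.

Lemma medC23 x y z : mu x y z = mu x z y.
Proof. by case: mu_median => mu_sym _ _; case: (mu_sym x y z). Qed.

Lemma med_rot x y z : mu x y z = mu y z x.
Proof. by case: mu_median => mu_sym _ _; case: (mu_sym x y z). Qed.

Lemma medC12 x y z : mu x y z = mu y x z.
Proof. by rewrite med_rot medC23. Qed.

Lemma med_rotr x y z : mu x y z = mu z x y.
Proof. by rewrite med_rot med_rot. Qed.

Lemma medxxy x y : mu x x y = x.
Proof. by case: mu_median. Qed.

Lemma medxyy x y : mu x y y = y.
Proof. by rewrite med_rot medxxy. Qed.

Lemma medxyx x y : mu x y x = x.
Proof. by rewrite medC23 medxxy. Qed.

Lemma med_distr x y z u v : mu (mu x y z) u v = mu x (mu y u v) (mu z u v).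
Proof. by case: mu_median. Qed.

Lemma medA p x y z : mu p (mu p x y) z = mu p x (mu p y z).
Proof. by rewrite (medC12 p x y) (medC12 p) med_distr medxxy (medC12 y) medC12. Qed.

Definition between x y z : Prop := mu x y z = z.

Lemma betweenC x y z : between x y z -> between y x z.
Proof. by rewrite /between medC12. Qed.

Lemma between_med12 x y z : between x y (mu x y z).
Proof. by rewrite /between (med_rotr x y (mu _ _ _)) (med_rotr x y z) med_distr medxxy medxyx. Qed.

Lemma between_med13 x y z : between x z (mu x y z).
Proof. by rewrite medC23; exact: between_med12. Qed.

Lemma between_med23 x y z : between y z (mu x y z).
Proof. by rewrite med_rot; exact: between_med12. Qed.

Lemma between_gate x y a b : between a (mu x y b) (mu x y a).
Proof. by rewrite /between !(med_rotr x y) -med_distr medxyx. Qed.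

Lemma med_retract x y a b c : mu x y (mu a b c) = mu (mu x y a) (mu x y b) (mu x y c).
Proof.
rewrite -between_med12 (med_rotr x y (mu a b c)) med_distr -!(med_rotr x y).
by rewrite (med_rotr x y (mu a _ _)) (medC12 a) med_distr -!(med_rotr x y) between_med12 medC12.
Qed.

Definition med_convex (U A : set X) : Prop :=
  forall a b c, A a -> A b -> U c -> A (mu a b c).

Lemma interval_convex x y : med_convex setT (between x y).
Proof.
move=> a b c xya xyb _; rewrite /between -[mu a b c in LHS]between_med12.
by rewrite (med_rotr a b) (med_rotr x y) med_distr -!(med_rotr x y) xya xyb -med_rotr between_med12.
Qed.

(* For three sets, the median of points of the pairwise intersections is common to all. *)
Lemma helly (I : eqType) (s : seq I) (U : set X) (A : I -> set X) : U !=set0 ->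
  (forall i, i \in s -> A i `<=` U) -> (forall i, i \in s -> med_convex U (A i)) ->
  {in s &, forall i j, A i `&` A j !=set0} -> exists2 x, U x & forall i, i \in s -> A i x.
Proof.
elim: s U A => [|k s IH] U A [u Uu] AU A_convex A_meet; first by exists u.
have ks : k \in k :: s by rewrite inE eqxx.
have sub i : i \in s -> i \in k :: s by rewrite inE orbC => ->.
have [|i _ x [] //|i /sub/A_convex Ai a b c [Aka Aia] [Akb Aib] Akc|i j si sj|x Akx Asx] :=
    IH (A k) (fun i => A k `&` A i).
- by have [x [Akx _]] := A_meet k k ks ks; exists x.
- by split; [apply: A_convex|apply: Ai] => //; apply: AU Akc.
- have [a [Aka Aia]] := A_meet k i ks (sub i si); have [b [Akb Ajb]] := A_meet k j ks (sub j sj).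
  have [c [Aic Ajc]] := A_meet i j (sub i si) (sub j sj).
  have [Ua Ub Uc] : [/\ U a, U b & U c].
    by split; [exact: AU Aka|exact: AU Akb|exact: AU (sub i si) _ Aic].
  exists (mu a b c); split; (split; first exact: A_convex).
  + by rewrite medC23; apply: A_convex => //; exact: sub.
  + by rewrite med_rot; apply: A_convex => //; exact: sub.
exists x; first exact: AU Akx.
by move=> i; rewrite inE => /predU1P[->//|/Asx[]].
Qed.

Definition interval_monotone (R : realDomainType) (U : set X) (f : X -> R) : Prop :=
  forall x y z, U x -> U y -> U z -> between x y z ->
    Num.min (f x) (f y) <= f z <= Num.max (f x) (f y).

End MedianAlgebra.

(** * Metric spaces *)

Section MetricSpace.
Variables (R : realType) (X : Type) (d : X -> X -> R).
Hypothesis d_metric : is_metric d.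

Lemma metric_ge0 x y : 0 <= d x y.
Proof. by case: d_metric. Qed.

Lemma metricxx x : d x x = 0.
Proof. by case: d_metric => _ d_eq0 _ _; apply/d_eq0. Qed.

Lemma metricC x y : d x y = d y x.
Proof. by case: d_metric. Qed.

Lemma metric_triangle x y z : d x z <= d x y + d y z.
Proof. by case: d_metric. Qed.

Lemma metric_le0 x y : d x y <= 0 -> x = y.
Proof.
by move=> d_le0; case: d_metric => _ d_eq0 _ _; apply/d_eq0/le_anti; rewrite d_le0 metric_ge0.
Qed.

Definition metric_closed (A : set X) : Prop := metric_open d (~` A).

Lemma metric_closed_adherent (A : set X) x : metric_closed A ->
  (forall e : R, 0 < e -> exists2 y, A y & d x y < e) -> A x.
Proof.
move=> A_closed x_adh; apply: contrapT => /A_closed[r r_gt0 ball_nA].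
by have [y Ay /ball_nA] := x_adh r r_gt0.
Qed.

Lemma sublevel_closed (L : R) (f : X -> R) t : 0 < L -> (forall x y, f x - f y <= L * d x y) ->
  metric_closed [set z | f z <= t].
Proof.
move=> L_gt0 f_lip z /negP; rewrite -ltNge => lt_t.
exists ((f z - t) / L); first by rewrite divr_gt0 // subr_gt0.
move=> y; rewrite ltr_pdivlMr // mulrC => ? /=; have := f_lip z y; lra.
Qed.

Variables (d' : X -> X -> R) (L : R).
Hypotheses (L_ge0 : 0 <= L) (d'_le : forall x y, d' x y <= L * d x y).

Lemma lipschitz_uniform (e : R) : 0 < e ->
  exists2 r : R, 0 < r & forall x y, d x y < r -> d' x y < e.
Proof.
move=> e_gt0; have L1_gt0 : 0 < L + 1 by rewrite ltr_wpDl.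
exists (e / (L + 1)); first by rewrite divr_gt0.
move=> x y; rewrite ltr_pdivlMr // => lt_e; apply: le_lt_trans (d'_le x y) _.
by apply: le_lt_trans lt_e; rewrite mulrC ler_wpM2l ?metric_ge0 // lerDl.
Qed.

Lemma metric_connected_lipschitz : metric_connected d -> metric_connected d'.
Proof.
have open_sub A : metric_open d' A -> metric_open d A.
  move=> A_open a /A_open[e /lipschitz_uniform[r r_gt0 r_small] A_ball].
  by exists r => // b /r_small/A_ball.
by case=> inhabited conn; split=> // A A_open nA_open; apply: conn; exact: open_sub.
Qed.

Lemma metric_complete_bilipschitz : (forall x y, d x y <= d' x y) ->
  metric_complete d -> metric_complete d'.
Proof.
move=> d_le complete u u_cauchy; have [|l ul] := complete u.
  move=> e /u_cauchy[N uN]; exists N => m n Nm Nn; exact: le_lt_trans (uN m n Nm Nn).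
exists l => e /lipschitz_uniform[r /ul[N uN] r_small].
by exists N => n /uN/r_small.
Qed.

End MetricSpace.

Section RealFacts.
Variable R : realType.

Lemma geometric_small (C e : R) : 0 < e ->
  exists N, forall n, (N <= n)%N -> C * 2^-1 ^+ n < e.
Proof.
move=> e_gt0; have half_lt1 : `|2^-1 : R| < 1 by rewrite gtr0_norm ?invr_gt0 // invf_lt1 ?ltr1n.
by have [N _ small] := cvgr_lt _ (cvg_geometric C half_lt1) _ e_gt0; exists N.
Qed.

Lemma geometric_cauchy (X : Type) (rho : X -> X -> R) (C : R) (u : nat -> X) :
  (forall m n, rho (u m) (u n) <= C * 2^-1 ^+ m + C * 2^-1 ^+ n) -> cauchy_wrt rho u.
Proof.
move=> rho_le e e_gt0; have [|N small] := @geometric_small C (e / 2); first by rewrite divr_gt0.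
exists N => m n /small small_m /small small_n; apply: le_lt_trans (rho_le m n) _; lra.
Qed.

Lemma glue_le (a b t : R) : (a <= 0 -> b < 0) ->
  (Num.min a 0 + Num.max b 0 <= t) = if t < 0 then a <= t else b <= t.
Proof.
move=> ab; have [t_lt0|t_ge0] := ltP t 0; case: (leP a 0) ab => [a_le0 /(_ isT) b_lt0|a_gt0 _];
  case: (leP b 0) => b0; apply/idP/idP => ?; lra.
Qed.

Lemma glue_ge (a b t : R) : (a <= 0 -> b < 0) ->
  (t <= Num.min a 0 + Num.max b 0) = if t <= 0 then t <= a else t <= b.
Proof.
move=> ab; have [t_le0|t_gt0] := leP t 0; case: (leP a 0) ab => [a_le0 /(_ isT) b_lt0|a_gt0 _];
  case: (leP b 0) => b0; apply/idP/idP => ?; lra.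
Qed.

End RealFacts.

(** * Complete connected median spaces *)

Section MedianSpace.
Variables (R : realType) (X : Type) (mu : X -> X -> X -> X) (dist : X -> X -> R).
Implicit Types (f : X -> R) (x y z : X).

Definition additive_on_intervals : Prop :=
  forall x y z, between mu x y z -> dist x y = dist x z + dist z y.

Hypotheses (mu_median : median_algebra mu) (dist_metric : is_metric dist).
Hypothesis dist_between : additive_on_intervals.

Let dist_ge0 := metric_ge0 dist_metric.
Let distC := metricC dist_metric.
Let dist_triangle := metric_triangle dist_metric.
Let distxx := metricxx dist_metric.

(* Adding up the two geodesics from a to b' through a' and from b to a' through b'
   leaves 2 dist a' b' <= 2 dist a b. *)
Lemma med_lipschitz x y a b : dist (mu x y a) (mu x y b) <= dist a b.
Proof.
set a' := mu x y a; set b' := mu x y b.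
have := dist_between (between_gate mu_median x y a b).
have := dist_between (between_gate mu_median x y b a).
have := dist_triangle a b b'; have := dist_triangle b a a'.
by rewrite -/a' -/b' (distC b' a') (distC b a); lra.
Qed.

Definition convex (A : set X) : Prop := med_convex mu setT A.

Lemma interval_closed x y : metric_closed dist (between mu x y).
Proof.
have -> : between mu x y = [set z | dist (mu x y z) z <= 0].
  apply/seteqP; split=> z; rewrite /between /=; first by move->; rewrite distxx.
  exact: (metric_le0 dist_metric).
apply: (@sublevel_closed _ _ _ 2) => // z w.
have := dist_triangle (mu x y z) (mu x y w) z; have := dist_triangle (mu x y w) w z.
by have := med_lipschitz x y z w; rewrite (distC w z); lra.
Qed.

Definition monotone_lipschitz : set (X -> R) :=
  [set f | interval_monotone mu setT f /\ forall x y, f x - f y <= dist x y].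

Lemma sublevel_convex f t : interval_monotone mu setT f -> convex [set z | f z <= t].
Proof.
move=> f_mono a b c /= fa fb _.
have /andP[_] := f_mono a b (mu a b c) I I I (between_med12 mu_median a b c).
by move=> /le_trans; apply; rewrite ge_max fa fb.
Qed.

Lemma superlevel_convex f t : interval_monotone mu setT f -> convex [set z | t <= f z].
Proof.
move=> f_mono a b c /= fa fb _.
have /andP[+ _] := f_mono a b (mu a b c) I I I (between_med12 mu_median a b c).
by apply: le_trans; rewrite le_min fa fb.
Qed.

Lemma interval_monotoneN (U : set X) f : interval_monotone mu U f -> interval_monotone mu U (\- f).
Proof.
move=> f_mono x y z Ux Uy Uz /(f_mono x y z Ux Uy Uz).
by rewrite -oppr_max -oppr_min !lerN2 andbC.
Qed.

Lemma interval_monotone_levels f : (forall t, convex [set z | f z <= t]) ->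
  (forall t, convex [set z | t <= f z]) -> interval_monotone mu setT f.
Proof.
move=> sub_convex sup_convex x y z _ _ _ <-; apply/andP; split.
  by apply: sup_convex => //=; rewrite ge_min lexx ?orbT.
by apply: sub_convex => //=; rewrite le_max lexx ?orbT.
Qed.

Lemma monotone_lipschitzN f : monotone_lipschitz f -> monotone_lipschitz (\- f).
Proof.
move=> [f_mono f_lip]; split; first exact: interval_monotoneN.
by move=> x y /=; rewrite opprK addrC distC.
Qed.

Lemma monotone_lipschitzD f c : monotone_lipschitz f -> monotone_lipschitz (fun z => f z + c).
Proof.
move=> [f_mono f_lip]; split=> [x y z _ _ _ /(f_mono x y z I I I)|x y].
  by rewrite -addr_minl -addr_maxl !lerD2r.
by rewrite opprD addrACA subrr addr0.
Qed.

Lemma monotone_lipschitz0 : monotone_lipschitz (fun=> 0).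
Proof. by split=> [x y z _ _ _ _|x y]; rewrite ?minxx ?maxxx ?lexx ?subrr. Qed.

Definition halfball (f : X -> R) (x : X) (r : R) : set X := [set z | f z <= f x + r].

Lemma halfball_convex f x r : monotone_lipschitz f -> convex (halfball f x r).
Proof. by case=> f_mono _; exact: sublevel_convex. Qed.

Lemma halfball_closed f x r : monotone_lipschitz f -> metric_closed dist (halfball f x r).
Proof. by case=> _ f_lip; apply: (@sublevel_closed _ _ _ 1) => // z w; rewrite mul1r. Qed.

Hypothesis dist_connected : metric_connected dist.

Lemma lipschitz_ivt f x y c : (forall x y, f x - f y <= dist x y) -> f x <= c <= f y ->
  exists2 z, between mu x y z & f z = c.
Proof.
move=> f_lip /andP[fx fy]; apply: contrapT => avoid; pose g a := f (mu x y a).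
have g_neq a : g a != c.
  by apply/eqP => ga; apply: avoid; exists (mu x y a) => //; exact: between_med12.
have g_lip a b : g a - g b <= dist a b := le_trans (f_lip _ _) (med_lipschitz x y a b).
have [_ connected] := dist_connected.
have [||all_lt|all_ge] := connected [set a | g a < c].
- move=> a /= ga; exists (c - g a); first by rewrite subr_gt0.
  by move=> b ab; have := g_lip b a; rewrite (distC b); lra.
- move=> a /negP; rewrite -leNgt le_eqVlt eq_sym (negPf (g_neq a)) /= => ga.
  exists (g a - c); first by rewrite subr_gt0.
  by move=> b ab /=; rewrite ltNge => /negP; apply; have := g_lip a b; lra.
- by have := all_lt y; rewrite /g /= medxyy // ltNge fy.
- by have := all_ge x; have := g_neq x; rewrite /g /= medxyx // lt_neqAle fx => ->.
Qed.

(* Each level set of the glued function is a level set of one of the two pieces. *)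
Lemma monotone_lipschitz_glue f h : monotone_lipschitz f -> monotone_lipschitz h ->
  (forall z, f z <= 0 -> h z < 0) ->
  monotone_lipschitz (fun z => Num.min (f z) 0 + Num.max (h z) 0).
Proof.
move=> [f_mono f_lip] [h_mono h_lip] fh.
have glue_lip x y : f x <= 0 -> 0 <= f y -> h y - f x <= dist y x.
  move=> fx fy; have [z xyz fz] := lipschitz_ivt f_lip (introT andP (conj fx fy)).
  have := fh z; rewrite fz lexx (distC y) (dist_between xyz) => /(_ isT) hz.
  by have := f_lip z x; have := h_lip y z; rewrite (distC z) (distC y) fz; lra.
split.
  apply: interval_monotone_levels => t.
    have -> : [set z | Num.min (f z) 0 + Num.max (h z) 0 <= t] =
        if t < 0 then [set z | f z <= t] else [set z | h z <= t].
      by apply/funext => z /=; rewrite (glue_le t (fh z)); case: ifP.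
    by case: ifP => _; exact: sublevel_convex.
  have -> : [set z | t <= Num.min (f z) 0 + Num.max (h z) 0] =
      if t <= 0 then [set z | t <= f z] else [set z | t <= h z].
    by apply/funext => z /=; rewrite (glue_ge t (fh z)); case: ifP.
  by case: ifP => _; exact: superlevel_convex.
move=> x y; have := dist_ge0 x y; have := f_lip x y; have := h_lip x y.
have := fh x; have := fh y; have := glue_lip y x.
case: (leP (f x) 0) => fx; case: (leP (f y) 0) => fy; case: (leP (h x) 0) => hx;
  case: (leP (h y) 0) => hy; lra.
Qed.

Definition dinf x y : R := sup [set f y - f x | f in monotone_lipschitz].

Lemma dinf_ge f x y : monotone_lipschitz f -> f y - f x <= dinf x y.
Proof.
move=> f_ml; apply: ub_le_sup; last by exists f.
by exists (dist y x) => _ [g [_ g_lip] <-].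
Qed.

Lemma dinf_le x y C : (forall f, monotone_lipschitz f -> f y - f x <= C) -> dinf x y <= C.
Proof.
move=> f_le; apply: ge_sup; last by move=> _ [f f_ml <-]; exact: f_le.
by exists (0 - 0), (fun=> 0) => //; exact: monotone_lipschitz0.
Qed.

Lemma dinfC x y : dinf x y = dinf y x.
Proof.
suff le_dinf a b : dinf a b <= dinf b a by apply: le_anti; rewrite !le_dinf.
by apply: dinf_le => f /monotone_lipschitzN/(dinf_ge b a) /=; lra.
Qed.

Lemma dinf_ge0 x y : 0 <= dinf x y.
Proof. by have := dinf_ge x y monotone_lipschitz0; rewrite subrr. Qed.

Lemma dinf_triangle x y z : dinf x z <= dinf x y + dinf y z.
Proof.
by apply: dinf_le => f f_ml; have := dinf_ge x y f_ml; have := dinf_ge y z f_ml; lra.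
Qed.

Lemma dinf_le_dist x y : dinf x y <= dist x y.
Proof. by apply: dinf_le => f [_ f_lip]; rewrite distC. Qed.

(* If the halfballs were disjoint, gluing f to - g would give a function of
   monotone_lipschitz separating x from y by r + s. *)
Lemma halfballs_meet f g x y r s : monotone_lipschitz f -> monotone_lipschitz g ->
  0 <= r -> 0 <= s -> dinf x y < r + s -> halfball f x r `&` halfball g y s !=set0.
Proof.
move=> f_ml g_ml r_ge0 s_ge0; apply: contraPP => /set0P/negP/negPn/eqP disj.
apply/negP; rewrite -leNgt.
pose u z := f z + (- f x - r); pose w z := - g z + (g y + s).
have uw z : u z <= 0 -> w z < 0.
  move=> uz; rewrite ltNge; apply/negP => wz; rewrite -[False]/(set0 z) -disj.
  by split; move: uz wz; rewrite /halfball /u /w /=; lra.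
have chi_ml : monotone_lipschitz (fun z => Num.min (u z) 0 + Num.max (w z) 0).
  apply: monotone_lipschitz_glue => //; apply: monotone_lipschitzD => //.
  exact: monotone_lipschitzN.
have ux : u x = - r by rewrite /u addrA subrr sub0r.
have wy : w y = s by rewrite /w addrA addNr add0r.
have wx := uw x; have uy : 0 < u y by rewrite ltNge; apply/negP => /uw; rewrite wy ltNge s_ge0.
have := dinf_ge x y chi_ml; rewrite ux wy (min_r (ltW uy)) max_l //.
rewrite min_l ?oppr_le0 // max_r; last by rewrite ltW // wx // ux oppr_le0.
by rewrite !addr0 add0r opprK addrC.
Qed.

Hypothesis dist_complete : metric_complete dist.

Lemma near_closest_close (A : set X) x0 (rho e : R) a b : convex A ->
  (forall w, A w -> rho - e <= dist x0 w) -> A a -> A b ->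
  dist x0 a <= rho + e -> dist x0 b <= rho + e -> dist a b <= 4 * e.
Proof.
move=> A_convex far Aa Ab a_near b_near; have Am : A (mu x0 a b).
  by rewrite med_rot //; exact: A_convex.
have := dist_between (between_med12 mu_median x0 a b).
have := dist_between (between_med13 mu_median x0 a b).
have := dist_between (between_med23 mu_median x0 a b).
by have := far _ Am; rewrite (distC a (mu _ _ _)); lra.
Qed.

Section CompleteHelly.
Variables (F : set (set X)) (B : set X) (x0 : X) (b : R).
Hypotheses (F_convex : F `<=` convex) (F_meet : forall C C', F C -> F C' -> C `&` C' !=set0).
Hypotheses (FB : F B) (B_bounded : forall x, B x -> dist x0 x <= b).
Implicit Types (s : seq (set X)).

Let within s := forall C, C \in s -> F C.
Let core s : set X := [set x | forall C, C \in s -> C x].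

Lemma within_cat s s' : within s -> within s' -> within (s ++ s').
Proof. by move=> Fs Fs' C; rewrite mem_cat => /orP[/Fs|/Fs']. Qed.

Lemma core_cat s s' x : core (s ++ s') x -> core s x /\ core s' x.
Proof. by move=> sx; split=> C Cs; apply: sx; rewrite mem_cat Cs ?orbT. Qed.

Lemma core_convex s : within s -> convex (core s).
Proof.
move=> Fs x y z sx sy _ C Cs.
by apply: (F_convex (Fs C Cs)) => //; [exact: sx|exact: sy].
Qed.

Lemma core_nonempty s : within s -> core s !=set0.
Proof.
move=> Fs; have [|//|C /Fs/F_convex//|C C' /Fs ? /Fs ?|x _ sx] := @helly X mu mu_median _ s setT id.
- by exists x0.
- exact: F_meet.
- by exists x.
Qed.

Lemma core_distance : exists rho : R,
  (forall e, 0 < e -> exists s, within s /\ forall x, core s x -> rho - e <= dist x0 x) /\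
  (forall s e, within s -> 0 < e -> exists x, core s x /\ dist x0 x <= rho + e).
Proof.
pose S : set R := [set r | exists2 s, within s & forall x, core s x -> r <= dist x0 x].
have S_sup : has_sup S.
  split; first by exists 0, [::].
  exists b => r [s Fs s_far].
  have [|x Bsx] := @core_nonempty (B :: s).
    by move=> C; rewrite inE => /predU1P[->//|/Fs].
  apply: le_trans (s_far x _) (B_bounded _); last by apply: Bsx; rewrite inE eqxx.
  by move=> C Cs; apply: Bsx; rewrite inE Cs orbT.
exists (sup S); split=> [e e_gt0|s e Fs e_gt0].
  have [r [s Fs s_far] /ltW r_gt] := sup_adherent e_gt0 S_sup.
  by exists s; split=> // x /s_far; exact: le_trans.
apply: contrapT => no; suff : sup S + e <= sup S by rewrite gerDl leNgt e_gt0.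
apply: ub_le_sup; first exact: S_sup.2.
exists s => // x sx; rewrite leNgt; apply/negP => x_near.
by apply: no; exists x; split=> //; exact: ltW.
Qed.

Lemma helly_complete : F `<=` metric_closed dist -> \bigcap_(C in F) C !=set0.
Proof.
move=> F_closed; have [rho [far near]] := core_distance.
have pow_gt0 k : 0 < 2^-1 ^+ k :> R by rewrite exprn_gt0 ?invr_gt0.
have [s sP] := choice (fun k => far _ (pow_gt0 k)).
have [z zP] := choice (fun k => near (s k) _ (proj1 (sP k)) (pow_gt0 k)).
have z_close k w : core (s k) w -> dist x0 w <= rho + 2^-1 ^+ k -> dist (z k) w <= 4 * 2^-1 ^+ k.
  move=> sw w_near; have [[Fs s_far] [zs z_near]] := (sP k, zP k).
  exact: near_closest_close (core_convex Fs) s_far zs sw z_near w_near.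
have z_cauchy : cauchy_wrt dist z.
  apply: (@geometric_cauchy _ _ _ 4) => j k.
  have e_min : 0 < Num.min (2^-1 ^+ j) (2^-1 ^+ k) :> R by rewrite lt_min !pow_gt0.
  have [w [/core_cat[sj sk] w_near]] := near _ _ (within_cat (sP j).1 (sP k).1) e_min.
  apply: le_trans (dist_triangle _ w _) _; rewrite (distC w).
  by apply: lerD; apply: z_close => //; apply: le_trans w_near _;
    rewrite lerD2l ge_min lexx ?orbT.
have [l zl] := dist_complete z_cauchy; exists l => C FC.
apply: (metric_closed_adherent (F_closed _ FC)) => e e_gt0.
have e2_gt0 : 0 < e / 2 by rewrite divr_gt0.
have [N1 small] := geometric_small 4 e2_gt0; have [N2 zl_small] := zl _ e2_gt0.
pose k := maxn N1 N2; have FC1 : within [:: C] by move=> C'; rewrite inE => /eqP->.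
have [w [/core_cat[sw Cw] w_near]] := near _ _ (within_cat (sP k).1 FC1) (pow_gt0 k).
exists w; first by apply: Cw; rewrite inE.
have := dist_triangle l (z k) w; have := z_close k w sw w_near; rewrite (distC l (z k)).
have := small _ (leq_maxl N1 N2); have := zl_small _ (leq_maxr N1 N2); rewrite -/k; lra.
Qed.

End CompleteHelly.

Definition dinf_ball x r : set X := [set z | forall g, monotone_lipschitz g -> halfball g x r z].

Lemma dinf_ball_bound x r z : dinf_ball x r z -> dinf x z <= r.
Proof. by move=> xz; apply: dinf_le => g /xz; rewrite /halfball /=; lra. Qed.

Lemma halfball_center f x r : 0 <= r -> halfball f x r x.
Proof. by rewrite /halfball /= lerDl. Qed.

Lemma dinf_ball_center x r : 0 <= r -> dinf_ball x r x.
Proof. by move=> r_ge0 g _; exact: halfball_center. Qed.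

Lemma dinf_ball_convex x r : convex (dinf_ball x r).
Proof.
by move=> a b c xa xb _ g g_ml; apply: (halfball_convex g_ml) => //; [exact: xa|exact: xb].
Qed.

Lemma dinf_ball_closed x r : metric_closed dist (dinf_ball x r).
Proof.
move=> z /existsNP[g /not_implyP[g_ml /(halfball_closed g_ml)[e e_gt0 e_out]]].
by exists e => // w /e_out g_out xw; apply/g_out/xw.
Qed.

Lemma dinf_ball_meets_halfball f x y r s : monotone_lipschitz f -> 0 <= r -> 0 <= s ->
  dinf x y < r + s -> dinf_ball x r `&` halfball f y s !=set0.
Proof.
move=> f_ml r_ge0 s_ge0 xy_lt.
have [fy gx] := (halfball_center f y s_ge0, dinf_ball_center x r_ge0).
have xyx : between mu x y x by exact: medxyx.
have xyy : between mu x y y by exact: medxyy.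
pose F := [set between mu x y; halfball f y s] `|` [set halfball g x r | g in monotone_lipschitz].
have [|||||z zF] := @helly_complete F (between mu x y) x (dist x y).
- move=> _ [[->|->]|[g g_ml <-]]; [exact: interval_convex|exact: halfball_convex..].
- move=> _ _ [[->|->]|[g g_ml <-]] [[->|->]|[g' g'_ml <-]]; try by [exists x | exists y].
  + by exists x; split=> //; exact: gx.
  + by rewrite setIC; exact: halfballs_meet.
  + by exists x; split=> //; exact: gx.
  + exact: halfballs_meet.
  + by exists x; split; exact: gx.
- by left; left.
- by move=> z /dist_between->; rewrite lerDl.
- move=> _ [[->|->]|[g g_ml <-]]; [exact: interval_closed|exact: halfball_closed..].
by exists z; split=> [g g_ml|]; apply: zF; [right; exists g|left; right].
Qed.

Section Hyperconvexity.
Variable N : R.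
Hypothesis dist_le_dinf : forall x y, dist x y <= N * dinf x y.
Hypothesis N_ge0 : 0 <= N.

Lemma dinf_balls_meet (I : Type) (i0 : I) (c : I -> X) (r : I -> R) :
  (forall i j, dinf (c i) (c j) < r i + r j) -> exists z, forall i, dinf (c i) z <= r i.
Proof.
move=> cr; have r_ge0 i : 0 <= r i by have := cr i i; have := dinf_ge0 (c i) (c i); lra.
pose F := [set dinf_ball (c i0) (r i0)] `|`
  [set halfball g (c i) (r i) | g in monotone_lipschitz & i in setT].
have [|||||z zF] := @helly_complete F (dinf_ball (c i0) (r i0)) (c i0) (N * r i0).
- move=> _ [->|[g g_ml [i _ <-]]]; [exact: dinf_ball_convex|exact: halfball_convex].
- move=> _ _ [->|[g g_ml [i _ <-]]] [->|[g' g'_ml [j _ <-]]].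
  + by exists (c i0); split; exact: dinf_ball_center.
  + exact: dinf_ball_meets_halfball.
  + by rewrite setIC; exact: dinf_ball_meets_halfball.
  + exact: halfballs_meet.
- by left.
- by move=> z /dinf_ball_bound ?; apply: le_trans (dist_le_dinf _ _) _; rewrite ler_wpM2l.
- move=> _ [->|[g g_ml [i _ <-]]]; [exact: dinf_ball_closed|exact: halfball_closed].
exists z => i; apply: dinf_ball_bound => g g_ml; apply: zF; right.
by exists g => //; exists i.
Qed.

Section FixedPoint.
Variables (H : Type) (mul : H -> H -> H) (one : H) (inv : H -> H) (act : H -> X -> X).
Hypotheses (H_group : is_group mul one inv) (act_isom : isometric_action mul one dist mu act).
Variables (x0 : X) (Delta : R).
Hypotheses (Delta_gt0 : 0 < Delta) (orbit_bounded : forall g, dist x0 (act g x0) <= Delta).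

Lemma act_invK g : cancel (act (inv g)) (act g).
Proof. by case: H_group act_isom => _ _ invP [act1 actM _ _] x; rewrite -actM (invP g).2. Qed.

Lemma actKinv g : cancel (act g) (act (inv g)).
Proof. by case: H_group act_isom => _ _ invP [act1 actM _ _] x; rewrite -actM (invP g).1. Qed.

Lemma dinf_act g x y : dinf (act g x) (act g y) = dinf x y.
Proof.
have [_ _ act_dist act_mu] := act_isom.
have dinf_le_act h a b : dinf (act h a) (act h b) <= dinf a b.
  apply: dinf_le => f [f_mono f_lip]; apply: (@dinf_ge (f \o act h)).
  split=> [u v z _ _ _ uvz|u v] /=.
    by apply: f_mono => //; rewrite /between -act_mu uvz.
  by rewrite -(act_dist h).
by apply: le_anti; rewrite dinf_le_act -{1}(actKinv g x) -{1}(actKinv g y) dinf_le_act.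
Qed.

Lemma invariant_of_le f : (forall g x, f (act g x) <= f x) -> forall g x, f (act g x) = f x.
Proof. by move=> f_le g x; apply: le_anti; rewrite f_le -{1}(actKinv g x) f_le. Qed.

Definition admissible f : Prop :=
  (forall x y, dinf x y <= f x + f y) /\ forall g x, f (act g x) = f x.

Definition almost_extremal f (e : R) : Prop :=
  forall x a, 0 < a -> exists y, f x + f y <= dinf x y + e + a.

Definition conjugate f x : R := sup (range (fun y => dinf x y - f y)).

Lemma conjugate_has_sup f x : admissible f -> has_sup (range (fun y => dinf x y - f y)).
Proof.
move=> [f_adm _]; split; first by exists (dinf x x - f x), x.
by exists (f x) => _ [y _ <-]; rewrite lerBlDr.
Qed.

Lemma conjugate_ge f x y : admissible f -> dinf x y - f y <= conjugate f x.
Proof. by move=> /(conjugate_has_sup x)[_ bounded]; apply: ub_le_sup => //; exists y. Qed.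

Lemma conjugate_le f x C : (forall y, dinf x y - f y <= C) -> conjugate f x <= C.
Proof. by move=> f_le; apply: ge_sup => [|_ [y _ <-] //]; exists (dinf x x - f x), x. Qed.

Lemma conjugate_act f g x : admissible f -> conjugate f (act g x) = conjugate f x.
Proof.
move=> f_adm; apply: invariant_of_le => h y; apply: conjugate_le => z.
have [_ f_inv] := f_adm; rewrite -(act_invK h z) dinf_act f_inv.
exact: conjugate_ge.
Qed.

(* Lang's averaging step towards an extremal function. *)
Definition improve f x : R := (f x + conjugate f x) / 2.

Lemma improve_le f x : admissible f -> improve f x <= f x.
Proof.
move=> [f_adm _]; suff : conjugate f x <= f x by rewrite /improve; lra.
by apply: conjugate_le => y; rewrite lerBlDr.
Qed.

Lemma improve_admissible f : admissible f -> admissible (improve f).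
Proof.
move=> f_adm; split=> [x y|g x].
  have := conjugate_ge x y f_adm; have := conjugate_ge y x f_adm.
  by rewrite (dinfC y x) /improve; lra.
by rewrite /improve conjugate_act //; case: f_adm => _ ->.
Qed.

Lemma improve_almost_extremal f e : admissible f -> almost_extremal f e ->
  almost_extremal (improve f) (e / 2).
Proof.
move=> f_adm f_ext x a a_gt0.
have [_ [y _ <-] y_sup] := sup_adherent a_gt0 (conjugate_has_sup x f_adm).
have : f x - e <= conjugate f x.
  apply/ler_addgt0Pr => b /(f_ext x)[z]; have := conjugate_ge x z f_adm; lra.
by exists y; have := improve_le y f_adm; move: y_sup; rewrite -/(conjugate f x) {2}/improve; lra.
Qed.

Definition radius x : R := sup (range (fun g => dinf x (act g x0))).

Lemma radius_has_sup x : has_sup (range (fun g => dinf x (act g x0))).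
Proof.
split; first by exists (dinf x (act one x0)), one.
exists (dinf x x0 + Delta) => _ [g _ <-]; apply: le_trans (dinf_triangle x x0 _) _.
by rewrite lerD2l; exact: le_trans (dinf_le_dist _ _) (orbit_bounded g).
Qed.

Lemma radius_ge x g : dinf x (act g x0) <= radius x.
Proof. by apply: ub_le_sup; [case: (radius_has_sup x)|exists g]. Qed.

Lemma radius_le x C : (forall g, dinf x (act g x0) <= C) -> radius x <= C.
Proof. by move=> le_C; apply: ge_sup => [|_ [g _ <-] //]; case: (radius_has_sup x). Qed.

Lemma radius_admissible : admissible radius.
Proof.
have [_ actM _ _] := act_isom; split=> [x y|].
  have := radius_ge x one; have := radius_ge y one.
  by have := dinf_triangle x (act one x0) y; rewrite (dinfC (act one x0) y); lra.
apply: invariant_of_le => g x; apply: radius_le => h.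
by rewrite -(act_invK g (act h x0)) dinf_act -actM; exact: radius_ge.
Qed.

Lemma radius_almost_extremal : almost_extremal radius Delta.
Proof.
move=> x a a_gt0; have [_ [g _ <-] g_sup] := sup_adherent a_gt0 (radius_has_sup x).
have radius_orbit : radius (act g x0) <= Delta.
  case: radius_admissible => _ ->; apply: radius_le => h.
  exact: le_trans (dinf_le_dist _ _) (orbit_bounded h).
by exists (act g x0); move: g_sup; rewrite -/(radius x); lra.
Qed.

Definition approximant k : X -> R := iter k improve radius.
Definition error k : R := Delta * 2^-1 ^+ k.

Lemma error_gt0 k : 0 < error k.
Proof. by rewrite mulr_gt0 // exprn_gt0 ?invr_gt0. Qed.

Lemma approximant_admissible k : admissible (approximant k).
Proof. by elim: k => [|k IH]; [exact: radius_admissible|exact: improve_admissible]. Qed.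

Lemma approximant_almost_extremal k : almost_extremal (approximant k) (error k).
Proof.
elim: k => [|k IH]; first by rewrite /error expr0 mulr1; exact: radius_almost_extremal.
by rewrite /error exprSr mulrA; apply: improve_almost_extremal => //; exact: approximant_admissible.
Qed.

Lemma approximant_anti j k x : (j <= k)%N -> approximant k x <= approximant j x.
Proof.
move=> /subnK <-; elim: (k - j)%N => //= n; apply: le_trans.
exact/improve_le/approximant_admissible.
Qed.

Lemma approximant_center k : exists z, approximant k z <= 3 * error k.
Proof.
have [|z z_center] := @dinf_balls_meet X x0 id (fun x => approximant k x + error k).
  move=> x y; have := (approximant_admissible k).1 x y; have := error_gt0 k; lra.
exists z; have [y] := approximant_almost_extremal k z (error_gt0 k).
by have := z_center y; rewrite dinfC; lra.
Qed.

Lemma bounded_orbit_fixed_point : exists x, forall g, act g x = x.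
Proof.
have [z z_center] := choice approximant_center.
have z_close j k : (j <= k)%N -> dinf (z j) (z k) <= 3 * error j + 3 * error k.
  move=> jk; apply: le_trans ((approximant_admissible k).1 _ _) (lerD _ (z_center k)).
  exact: le_trans (approximant_anti _ jk) (z_center j).
have [|l zl] := dist_complete (u := z).
  apply: (@geometric_cauchy _ _ _ (N * (3 * Delta))) => j k; rewrite -mulrDr -!mulrA.
  apply: le_trans (dist_le_dinf _ _) _; rewrite ler_wpM2l // mulrDr !mulrDr.
  by have [/z_close//|/ltnW/z_close] := leqP j k; rewrite dinfC addrC.
exists l => g; apply: (metric_le0 dist_metric); apply: le_trans (dist_le_dinf _ _) _.
suff : dinf (act g l) l <= 0 by exact: mulr_ge0_le0.
apply/ler_addgt0Pr => e e_gt0; rewrite add0r.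
have e4_gt0 : 0 < e / 4 by rewrite divr_gt0.
have [N1 small] := geometric_small (6 * Delta) e4_gt0; have [N2 zl_small] := zl _ e4_gt0.
pose n := maxn N1 N2; have [n_adm n_inv] := approximant_admissible n.
have := dinf_triangle (act g l) (act g (z n)) l; rewrite dinf_act (dinfC l).
have := dinf_triangle (act g (z n)) (z n) l; have := dinf_le_dist (z n) l.
have := n_adm (act g (z n)) (z n); rewrite n_inv; have := z_center n.
by have := small n (leq_maxl _ _); have := zl_small n (leq_maxr _ _); rewrite /error; lra.
Qed.

End FixedPoint.

End Hyperconvexity.

End MedianSpace.

(** * Finite subalgebras and their walls *)

Section FiniteSubalgebra.
Variables (X : choiceType) (mu : X -> X -> X -> X).
Hypothesis mu_median : median_algebra mu.
Implicit Types (M : {fset X}) (s : seq X).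

(* For fixed p, mu p is a semilattice operation over which mu distributes. *)
Inductive meets (p : X) s : X -> Prop :=
| meets_base x : x \in s -> meets p s x
| meets_step x y : meets p s x -> meets p s y -> meets p s (mu p x y).

Lemma meets_cons p a s x : meets p (a :: s) x ->
  [\/ x = a, meets p s x | exists2 y, meets p s y & x = mu p a y].
Proof.
have meetC y z : mu p y z = mu p z y by exact: medC23.
have meetA y z t : mu p (mu p y z) t = mu p y (mu p z t) by exact: medA.
have meetxx y : mu p y y = y by exact: medxyy.
elim=> {x} [x|x y _ [->|xs|[t ts ->]] _ [->|ys|[u us ->]]].
- by rewrite inE => /predU1P[->|xs]; [apply: Or31|apply/Or32/meets_base].
- by rewrite meetxx; apply: Or31.
- by apply: Or33; exists y.
- by rewrite -meetA meetxx; apply: Or33; exists u.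
- by rewrite meetC; apply: Or33; exists x.
- by apply/Or32/meets_step.
- by rewrite -meetA (meetC x) meetA; apply: Or33; exists (mu p x u) => //; apply: meets_step.
- by rewrite meetC -meetA meetxx; apply: Or33; exists t.
- by rewrite meetA; apply: Or33; exists (mu p t y) => //; apply: meets_step.
- rewrite meetA -(meetA t) (meetC t) meetA -meetA meetxx.
  by apply: Or33; exists (mu p t u) => //; apply: meets_step.
Qed.

Lemma meets_finite p s : exists T : {fset X}, forall x, x \in T <-> meets p s x.
Proof.
elim: s => [|a s [T Ts]].
  by exists fset0 => x; split; rewrite ?in_fset0 //; elim=> // ? ? _ + _ _.
have sub x : meets p s x -> meets p (a :: s) x.
  elim=> [y ys|y z _ + _]; [by apply: meets_base; rewrite inE ys orbT|exact: meets_step].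
have a_meets : meets p (a :: s) a by apply: meets_base; rewrite inE eqxx.
exists (a |` (T `|` [fset mu p a y | y in T]))%fset => x; rewrite !inE; split.
  case/or3P=> [/eqP->//|/Ts/sub//|/imfsetP[y /= /Ts/sub ys ->]].
  exact: meets_step.
case/meets_cons => [->|/Ts->|[y /Ts yT ->]]; rewrite ?eqxx ?orbT //.
by apply/or3P; apply: Or33; apply/imfsetP; exists y.
Qed.

Lemma meets_med p M x y z : subalgebra mu M ->
  meets p M x -> meets p M y -> meets p M z -> meets p M (mu x y z).
Proof.
move=> sM Mx; elim: Mx y z => {x} [x xM|x x' _ IHx _ IHx'] y z My Mz; last first.
  by rewrite (med_distr mu_median); apply: meets_step; [exact: IHx|exact: IHx'].
elim: My z Mz => {y} [y yM|y y' _ IHy _ IHy'] z Mz; last first.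
  rewrite (medC12 mu_median) (med_distr mu_median).
  by apply: meets_step; rewrite (medC12 mu_median); [exact: IHy|exact: IHy'].
elim: Mz => {z} [z zM|z z' _ IHz _ IHz']; first by apply: meets_base; apply: sM.
by rewrite (med_rotr mu_median) (med_distr mu_median) -!(med_rotr mu_median x y); apply: meets_step.
Qed.

Lemma subalgebra_adjoin p M : subalgebra mu M ->
  exists M', [/\ subalgebra mu M', {subset M <= M'} & p \in M'].
Proof.
move=> sM; have [T TM] := meets_finite p M; exists (p |` T)%fset.
have T_meet x y : x \in T -> y \in T -> mu p x y \in T.
  by move=> /TM xM /TM yM; apply/TM; exact: meets_step.
split=> [x y z|x xM|]; last by rewrite !inE eqxx.
  rewrite !inE => /predU1P[->|xT] /predU1P[->|yT] /predU1P[->|zT];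
    rewrite ?medxxy ?medxyy ?medxyx ?eqxx //.
  - by rewrite T_meet ?orbT.
  - by rewrite (medC12 mu_median) T_meet ?orbT.
  - by rewrite -(med_rot mu_median) T_meet ?orbT.
  - by rewrite (TM _).2 ?orbT //; apply: meets_med => //; exact/TM.
by rewrite !inE (TM x).2 ?orbT //; exact: meets_base.
Qed.

Lemma subalgebra_extend s M : subalgebra mu M ->
  exists M', [/\ subalgebra mu M', {subset M <= M'} & {subset s <= M'}].
Proof.
move=> sM; elim: s => [|p s [M1 [sM1 MM1 sM1s]]]; first by exists M; split.
have [M' [sM' M1M' pM']] := subalgebra_adjoin p sM1.
exists M'; split=> // x; first by move/MM1/M1M'.
by rewrite inE => /predU1P[->//|/sM1s/M1M'].
Qed.

Lemma subalgebra0 : subalgebra mu fset0.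
Proof. by move=> x y z; rewrite in_fset0. Qed.

Lemma subalgebra_gen s : exists M, subalgebra mu M /\ {subset s <= M}.
Proof. by have [M [sM _ ?]] := subalgebra_extend s subalgebra0; exists M. Qed.

End FiniteSubalgebra.

Section Walls.
Variables (X : choiceType) (mu : X -> X -> X -> X).
Hypothesis mu_median : median_algebra mu.
Implicit Types (M h k : {fset X}) (a b c x y z : X).

Lemma convex_inP M h : reflect
  (forall a b c, a \in h -> b \in h -> c \in M -> between mu a b c -> c \in h) (convex_in mu M h).
Proof.
apply: (iffP allP) => [h_conv a b c ah bh cM abc|h_conv a ah].
  by have /allP/(_ b bh)/allP/(_ c cM)/implyP := h_conv a ah; apply; apply/eqP.
apply/allP => b bh; apply/allP => c cM; apply/implyP => /eqP.
exact: h_conv.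
Qed.

Lemma halfspace_sub M h : halfspace mu M h -> {subset h <= M}.
Proof. by case/and5P=> /fsubsetP. Qed.

Lemma halfspaceC M h : halfspace mu M h -> halfspace mu M (M `\` h)%fset.
Proof.
case/and5P=> hM h0 hc h_conv hc_conv; apply/and5P; rewrite fsetDK //.
by split=> //; exact: fsubsetDl.
Qed.

Lemma halfspace_med_in M h a b c : subalgebra mu M -> halfspace mu M h ->
  a \in h -> b \in h -> c \in M -> mu a b c \in h.
Proof.
move=> sM hh ah bh cM; have hM := halfspace_sub hh; case/and5P: hh => _ _ _ /convex_inP h_conv _.
by apply: (h_conv a b) => //; [apply: sM => //; exact: hM|exact: between_med12].
Qed.

Lemma halfspace_med M h a b c : subalgebra mu M -> halfspace mu M h ->
  a \in M -> b \in M -> c \in M -> (a \in h) = (b \in h) -> (mu a b c \in h) = (a \in h).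
Proof.
move=> sM hh aM bM cM; case: (boolP (a \in h)) => ah /esym bh.
  by rewrite (halfspace_med_in sM hh) ?ah.
have := halfspace_med_in (a := a) (b := b) (c := c) sM (halfspaceC hh).
by rewrite !inE ah bh aM bM cM => /(_ isT isT isT)/andP[/negbTE].
Qed.

Lemma halfspace_intro M (P : pred X) a b : a \in M -> b \in M -> P a -> ~~ P b ->
  (forall x y z, x \in M -> y \in M -> z \in M -> P x = P y -> P (mu x y z) = P x) ->
  halfspace mu M [fset x in M | P x]%fset.
Proof.
move=> aM bM Pa nPb P_med; set h := [fset x in M | P x]%fset.
have inh x : (x \in h) = (x \in M) && P x by rewrite !inE.
have inC x : (x \in M `\` h)%fset = (x \in M) && ~~ P x.
  by rewrite inE inh; case: (x \in M); rewrite ?andbT ?andbF.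
apply/and5P; split.
- by apply/fsubsetP => x; rewrite inh => /andP[].
- by apply/fset0Pn; exists a; rewrite inh aM.
- by apply/fset0Pn; exists b; rewrite inC bM.
- apply/convex_inP => x y z; rewrite !inh => /andP[xM Px] /andP[yM Py] zM xyz.
  by rewrite zM -xyz P_med ?Px ?Py.
- apply/convex_inP => x y z; rewrite !inC => /andP[xM Px] /andP[yM Py] zM xyz.
  by rewrite zM -xyz P_med // (negPf Px) (negPf Py).
Qed.

Lemma sep_halfE M a b h : (h \in sep_half mu M a b) = [&& halfspace mu M h, a \in h & b \notin h].
Proof.
rewrite !inE /= fpowersetE -andbA; case: (boolP (halfspace mu M h)) => [hh|]; last by rewrite andbF.
by have /and5P[-> _ _ _ _] := hh.
Qed.

Lemma sep_halfP M a b h :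
  reflect [/\ halfspace mu M h, a \in h & b \notin h] (h \in sep_half mu M a b).
Proof. by rewrite sep_halfE; exact: and3P. Qed.

Lemma sep_half_setC M a b h : a \in M -> b \in M -> h \in sep_half mu M a b ->
  (M `\` h)%fset \in sep_half mu M b a.
Proof.
move=> aM bM /sep_halfP[hh ah bh]; apply/sep_halfP; split; first exact: halfspaceC.
  by rewrite inE bh.
by rewrite inE ah.
Qed.

Lemma sep_half_swap M a b : a \in M -> b \in M ->
  sep_half mu M b a = [fset (M `\` h)%fset | h in sep_half mu M a b]%fset.
Proof.
move=> aM bM; apply/fsetP => h; apply/idP/imfsetP => [hs|[k /= ks ->]]; last exact: sep_half_setC.
exists (M `\` h)%fset; first exact: sep_half_setC.
by case/sep_halfP: hs => /and5P[hM _ _ _ _] _ _; rewrite fsetDK.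
Qed.

Lemma setC_inj_in M a b : {in sep_half mu M a b &, injective (fun h => M `\` h)%fset}.
Proof.
move=> h k /sep_halfP[/and5P[hM _ _ _ _] _ _] /sep_halfP[/and5P[kM _ _ _ _] _ _] hk.
by rewrite -(fsetDK hM) hk fsetDK.
Qed.

Lemma card_sep_half_swap M a b : a \in M -> b \in M ->
  #|` sep_half mu M b a| = #|` sep_half mu M a b|.
Proof.
by move=> aM bM; rewrite (sep_half_swap aM bM) [LHS]card_in_imfset //; exact: setC_inj_in.
Qed.

Lemma edgeC M a b : edge mu M a b = edge mu M b a.
Proof.
rewrite /edge; case: (boolP (a \in M)) => aM; case: (boolP (b \in M)) => bM //=.
by rewrite (card_sep_half_swap aM bM).
Qed.

Lemma sep_half_restrict M M' a b h : subalgebra mu M -> subalgebra mu M' -> {subset M <= M'} ->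
  a \in M -> b \in M -> h \in sep_half mu M' a b -> (M `&` h)%fset \in sep_half mu M a b.
Proof.
move=> sM sM' MM' aM bM /sep_halfP[hh ah bh]; apply/sep_halfP.
have -> : (M `&` h = [fset x in M | x \in h])%fset by apply/fsetP => x; rewrite !inE.
split; rewrite ?inE ?aM ?(negPf bh) ?ah ?andbF //.
apply: (@halfspace_intro M (mem h) a b) => // x y z xM yM zM.
by apply: (halfspace_med sM' hh); exact: MM'.
Qed.

Lemma sep_half_edge M a b h k : edge mu M a b -> h \in sep_half mu M a b ->
  k \in sep_half mu M a b -> h = k.
Proof. by case/and3P=> _ _ /cardfs1P[g ->]; rewrite !inE => /eqP-> /eqP->. Qed.

(* The fibres of the retraction mu x y over the two endpoints are the sides of the only wall. *)
Lemma adjacent_edge M x y : subalgebra mu M -> x \in M -> y \in M -> x != y ->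
  (forall z, z \in M -> between mu x y z -> z = x \/ z = y) -> edge mu M x y.
Proof.
move=> sM xM yM xy adj.
have retr a : a \in M -> mu x y a = x \/ mu x y a = y.
  by move=> aM; apply: adj; [exact: sM|exact: between_med12].
pose h := [fset a in M | mu x y a == x]%fset.
have hs : h \in sep_half mu M x y.
  apply/sep_halfP; split; last 2 first.
  - by rewrite !inE xM (medxyx mu_median) eqxx.
  - by rewrite !inE yM (medxyy mu_median) eq_sym (negPf xy).
  apply: (@halfspace_intro M (fun a => mu x y a == x) x y) => //.
  - by rewrite (medxyx mu_median).
  - by rewrite (medxyy mu_median) eq_sym.
  move=> u v w uM vM wM; rewrite (med_retract mu_median).
  case: (retr u uM) => ->; case: (retr v vM) => ->; rewrite ?eqxx ?(medxxy mu_median) ?eqxx //.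
    by rewrite eq_sym (negPf xy).
  by rewrite eq_sym (negPf xy).
rewrite /edge xM yM /=; apply/cardfs1P; exists h; apply/fsetP => k; rewrite inE.
apply/idP/eqP => [/sep_halfP[hk xk yk]|->//]; apply/fsetP => a; rewrite !inE.
case: (boolP (a \in M)) => aM /=; last by apply: contraNF aM => /(halfspace_sub hk).
have [ax|ay] := retr a aM; rewrite ?ax ?ay ?eqxx.
  apply: contraTT xk => ak; rewrite -ax (med_rot mu_median).
  by rewrite (halfspace_med sM hk) // (negPf yk) (negPf ak).
rewrite eq_sym (negPf xy); apply: contraNF yk => ak; rewrite -ay (medC23 mu_median).
by rewrite (halfspace_med sM hk) // ak.
Qed.

End Walls.
(** * The wall metrics of finite subalgebras *)

Lemma ler_sum_fsubset (R : numDomainType) (K : choiceType) (A B : {fset K}) (F : K -> R) :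
  (A `<=` B)%fset -> (forall i, i \in B -> 0 <= F i) ->
  \sum_(i <- A) F i <= \sum_(i <- B) F i.
Proof.
move=> AB F_ge0; rewrite [leRHS](big_fsetID _ (mem A)) /=.
have -> : [fset i in B | i \in A]%fset = A.
  apply/fsetP=> i; rewrite !inE andbC.
  by case: (boolP (i \in A)) => //= /(fsubsetP AB).
by rewrite lerDl big_seq; apply: sumr_ge0 => i; rewrite !inE => /andP[/F_ge0].
Qed.

Section WallMetric.
Variables (R : realType) (X : choiceType) (d : X -> X -> R) (mu : X -> X -> X -> X).
Hypotheses (mu_median : median_algebra mu) (d_metric : is_metric d).
Implicit Types (M h k : {fset X}) (a b c x y z : X).

Local Notation lambda := (lambda_max d mu).
Local Notation dW := (dM d mu).

Lemma lambda_max_ge M h a b : edge mu M a b -> a \in h -> b \notin h -> d a b <= lambda M h.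
Proof.
move=> ab ah bh; have/and3P[aM bM _] := ab.
apply: (@bigmax_sup_seq _ _ _ _ _ a) => //; apply: (@bigmax_sup_seq _ _ _ _ _ b) => //.
by rewrite ab ah.
Qed.

Lemma lambda_max_le M h C : 0 <= C ->
  (forall a b, edge mu M a b -> a \in h -> b \notin h -> d a b <= C) -> lambda M h <= C.
Proof.
move=> C_ge0 d_le; apply: bigmax_le => // a _; apply: bigmax_le => // b.
by case/andP=> /andP[]; apply: d_le.
Qed.

Lemma lambda_max_ge0 M h : 0 <= lambda M h.
Proof.
rewrite /lambda_max; elim/big_ind: _ => // [u v u_ge0 _|a _]; first by rewrite le_max u_ge0.
elim/big_ind: _ => // [u v u_ge0 _|b _]; first by rewrite le_max u_ge0.
exact: metric_ge0 d_metric _ _.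
Qed.

Lemma lambda_max_setC M h : lambda M (M `\` h)%fset = lambda M h.
Proof.
apply: le_anti; apply/andP; split; apply: lambda_max_le; rewrite ?lambda_max_ge0 // => a b ab;
  have/and3P[aM bM _] := ab.
  rewrite !inE bM andbT negbK => /andP[ah _] bh.
  by rewrite (metricC d_metric); apply: lambda_max_ge; rewrite // edgeC.
move=> ah bh; rewrite (metricC d_metric); apply: lambda_max_ge; rewrite ?inE ?ah ?bh //=.
by rewrite edgeC.
Qed.

Lemma dM_in M x y : x \in M -> y \in M -> dW M x y = \sum_(h <- sep_half mu M x y) lambda M h.
Proof. by move=> xM yM; rewrite /dM xM yM. Qed.

Lemma dM_out M x y : ~~ ((x \in M) && (y \in M)) -> dW M x y = 0.
Proof. by rewrite /dM => /negPf->. Qed.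

Lemma dM_ge0 M x y : 0 <= dW M x y.
Proof. by rewrite /dM; case: ifP => // _; apply: sumr_ge0 => *; exact: lambda_max_ge0. Qed.

Lemma dMxx M x : dW M x x = 0.
Proof.
rewrite /dM; case: ifP => // _; rewrite big_seq big1 // => h.
by rewrite sep_halfE andbN andbF.
Qed.

Lemma dMC M x y : dW M x y = dW M y x.
Proof.
have [/andP[xM yM]|xyM] := boolP ((x \in M) && (y \in M)); last by rewrite !dM_out // andbC.
rewrite !dM_in // (sep_half_swap mu xM yM) [RHS]big_imfset /=; last exact: setC_inj_in.
by apply: eq_bigr => h _; rewrite lambda_max_setC.
Qed.

Lemma dM_halfspaces M x y : x \in M -> y \in M -> dW M x y =
  \sum_(h <- fpowerset M | halfspace mu M h) (if (x \in h) && (y \notin h) then lambda M h else 0).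
Proof.
move=> xM yM; rewrite dM_in // /sep_half -big_fset_condE -big_mkcondr /=.
by apply: eq_bigl => h; rewrite andbA.
Qed.

Lemma dM_between M x y z : subalgebra mu M -> x \in M -> y \in M -> z \in M ->
  between mu x y z -> dW M x y = dW M x z + dW M z y.
Proof.
move=> sM xM yM zM xyz; rewrite !dM_halfspaces // -big_split /=; apply: eq_bigr => h hh.
have := halfspace_med mu_median sM hh xM yM zM; rewrite xyz.
case: (x \in h); case: (y \in h); case: (z \in h) => med_xy /=; rewrite ?addr0 ?add0r //;
  by have := med_xy erefl.
Qed.

Lemma d_le_dM M x y : subalgebra mu M -> x \in M -> y \in M -> d x y <= dW M x y.
Proof.
move=> sM; pose I x y := [fset z in M | mu x y z == z]%fset.
have IE u v w : (w \in I u v) = (w \in M) && (mu u v w == w) by rewrite !inE.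
have IC u v : I u v = I v u by apply/fsetP=> w; rewrite !IE (medC12 mu_median).
have I_proper u v z : u \in M -> v \in M -> between mu u v z -> z != v -> (I u z `<` I u v)%fset.
  move=> uM vM uvz zv; rewrite fproperE; apply/andP; split.
    apply/fsubsetP=> w; rewrite !IE => /andP[-> /eqP uzw] /=.
    by rewrite -{1}uzw -(medA mu_median) uvz uzw.
  apply/fsubsetPn; exists v; rewrite !IE vM /=; first by rewrite (medxyy mu_median).
  by rewrite (medC23 mu_median) uvz.
have [n] := ubnP #|` I x y|; elim: n x y => // n IH x y card_lt xM yM.
have [<-|xy] := eqVneq x y; first by rewrite (metricxx d_metric) dM_ge0.
have [[z [zM xyz zx zy]]|adj] :=
    pselect (exists z, [/\ z \in M, between mu x y z, z != x & z != y]).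
  have yxz := betweenC mu_median xyz.
  rewrite (dM_between sM xM yM zM xyz); apply: le_trans (metric_triangle d_metric x z y) _.
  apply: lerD; apply: IH => //.
    exact: leq_trans (fproper_ltn_card (I_proper _ _ _ xM yM xyz zy)) card_lt.
  by rewrite IC; apply: leq_trans (fproper_ltn_card (I_proper _ _ _ yM xM yxz zx)) _; rewrite IC.
have xy_edge : edge mu M x y.
  apply: adjacent_edge => // z zM xyz; apply: contrapT => /not_orP[/eqP zx /eqP zy].
  by apply: adj; exists z.
have/and3P[_ _ /cardfs1P[h hE]] := xy_edge; rewrite dM_in // hE big_seq_fset1.
have /sep_halfP[_ xh yh] : h \in sep_half mu M x y by rewrite hE inE.
exact: lambda_max_ge.
Qed.

Section Monotone.
Variables (M M' : {fset X}).
Hypotheses (sM : subalgebra mu M) (sM' : subalgebra mu M') (MM' : {subset M <= M'}).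

Lemma lambda_max_le_refinement x y h : x \in M -> y \in M -> h \in sep_half mu M x y ->
  lambda M h <= \sum_(k <- sep_half mu M' x y | (M `&` k)%fset == h) lambda M' k.
Proof.
move=> xM yM hs; apply: lambda_max_le => [|a b ab ah bh].
  by apply: sumr_ge0 => k _; exact: lambda_max_ge0.
have/and3P[aM bM _] := ab; apply: le_trans (d_le_dM sM' (MM' aM) (MM' bM)) _.
rewrite dM_in ?MM' // [leRHS]big_fset_condE.
apply: ler_sum_fsubset => [|k _]; last exact: lambda_max_ge0.
apply/fsubsetP => k ks; have ks_ab := sep_half_restrict mu_median sM sM' MM' aM bM ks.
have /sep_halfP[hh xh yh] := hs; have hab : h \in sep_half mu M a b by apply/sep_halfP.
have khE := sep_half_edge ab ks_ab hab; have /sep_halfP[hk _ _] := ks.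
apply/imfsetP; exists k => //; apply/andP; split; last exact/eqP.
by apply/sep_halfP; move: xh yh; rewrite -khE !inE xM yM.
Qed.

Lemma dM_mono x y : x \in M -> y \in M -> dW M x y <= dW M' x y.
Proof.
move=> xM yM; rewrite !dM_in ?MM' //.
apply: (@le_trans _ _ (\sum_(h <- sep_half mu M x y)
    \sum_(k <- sep_half mu M' x y | (M `&` k)%fset == h) lambda M' k)).
  by rewrite !big_seq; apply: ler_sum => h; exact: lambda_max_le_refinement.
rewrite (exchange_big_dep xpredT) //= !big_seq; apply: ler_sum => k ks.
rewrite big_fset_condE; set fibre := [fset _ in _ | _]%fset.
suff -> : fibre = [fset (M `&` k)%fset]%fset by rewrite big_seq_fset1.
apply/fsetP => h; apply/imfsetP/fset1P => [[h' /= /andP[_ /eqP kh'] ->]//|->].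
by exists (M `&` k)%fset => //; apply/andP; split=> //; exact: sep_half_restrict ks.
Qed.

End Monotone.

End WallMetric.

(** * Chains and antichains of walls *)

Section WeightedMirsky.
Variables (R : realDomainType) (T : choiceType) (leT : rel T).
Hypotheses (leT_refl : reflexive leT) (leT_trans : transitive leT) (leT_anti : antisymmetric leT).
Implicit Types (S C A : {fset T}).

Definition chain C : Prop := {in C &, total leT}.
Definition antichain A : Prop := {in A &, forall x y, leT x y -> x = y}.
Definition minimals S : {fset T} := [fset x in S | all (fun y => leT y x ==> (y == x)) S]%fset.

Lemma minimalsP S x : reflect (x \in S /\ forall y, y \in S -> leT y x -> y = x) (x \in minimals S).
Proof.
rewrite !inE; apply: (iffP andP) => -[xS x_min]; split=> //.
  by move=> y yS yx; have /allP/(_ y yS)/implyP/(_ yx)/eqP := x_min.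
by apply/allP => y yS; apply/implyP => /(x_min y yS) ->.
Qed.

Lemma minimals_sub S : (minimals S `<=` S)%fset.
Proof. by apply/fsubsetP => x /minimalsP[]. Qed.

Lemma minimals_antichain S : antichain (minimals S).
Proof. by move=> x y /minimalsP[xS _] /minimalsP[_ y_min] /(y_min x xS). Qed.

Lemma minimal_below S x : x \in S -> exists2 m, m \in minimals S & leT m x.
Proof.
have [n] := ubnP #|` [fset y in S | leT y x]|%fset; elim: n x => // n IH x card_lt xS.
have [x_min|] := boolP (x \in minimals S); first by exists x.
rewrite !inE xS /= => /allPn[y yS]; rewrite negb_imply => /andP[yx y_neq].
have [||m mS my] := IH y => //; last by exists m => //; exact: leT_trans yx.
move: card_lt; rewrite ltnS; apply: leq_trans; apply: fproper_ltn_card.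
rewrite fproperE; apply/andP; split.
  by apply/fsubsetP => z; rewrite !inE => /andP[-> zy]; exact: leT_trans yx.
apply/fsubsetPn; exists x; rewrite !inE xS /= ?leT_refl //.
by apply: contra y_neq => xy; apply/eqP/leT_anti; rewrite yx.
Qed.

Lemma chain_extend S C : S != fset0 -> (C `<=` S)%fset -> chain C ->
  exists D, [/\ (C `<=` D)%fset, (D `<=` S)%fset, chain D & exists2 m, m \in D & m \in minimals S].
Proof.
move=> S_neq0 CS C_chain.
suff [m m_min mC] : exists2 m, m \in minimals S & forall x, x \in C -> leT m x.
  exists (m |` C)%fset; split.
  - exact: fsubsetUr.
  - by rewrite fsubUset fsub1set CS (fsubsetP (minimals_sub S)).
  - move=> x y; rewrite !inE => /predU1P[->|xC] /predU1P[->|yC]; rewrite ?leT_refl ?mC ?orbT //.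
    exact: C_chain.
  - by exists m; rewrite // !inE eqxx.
have [->|/fset0Pn[c /minimal_below[b b_min _]]] := eqVneq C fset0.
  by have /fset0Pn[x /minimal_below[m m_min _]] := S_neq0; exists m.
have /minimalsP[bC b_least] := b_min; have [m m_min mb] := minimal_below (fsubsetP CS b bC).
exists m => // x xC; have /orP[bx|xb] := C_chain b x bC xC; first exact: leT_trans bx.
by rewrite (b_least x xC xb).
Qed.

Lemma fset_argmin S (w : T -> R) : S != fset0 ->
  exists2 e, e \in S & forall x, x \in S -> w e <= w x.
Proof.
case/fset0Pn => x xS.
have [e _ e_min] := arg_minP (fun i : S => w (val i)) (isT : xpredT [` xS]%fset).
by exists (val e); [exact: valP|move=> y yS; exact: (e_min [` yS]%fset)].
Qed.

Lemma sum_indicator S A (c : R) : (A `<=` S)%fset ->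
  \sum_(x <- S) (if x \in A then c else 0) = c * #|` A|%:R.
Proof.
move=> AS; rewrite -big_mkcond big_fset_condE /=.
have -> : [fset x in S | x \in A]%fset = A.
  apply/fsetP => x; rewrite !inE; apply: andb_idl; exact: (fsubsetP AS).
by rewrite big_const_seq count_predT iter_addr_0 mulr_natr.
Qed.

Lemma ler_sum_pos_part S (w : T -> R) :
  \sum_(x <- S) w x <= \sum_(x <- [fset x in S | 0 < w x]%fset) w x.
Proof.
rewrite (big_fsetID _ (fun x => 0 < w x)) /= gerDl big_seq.
by apply: sumr_le0 => x; rewrite !inE -leNgt => /andP[].
Qed.

(* Lowering all minimal weights by their minimum lowers the total by at most N times
   what every maximal chain loses. *)
Lemma heavy_chain (N : nat) S (w : T -> R) : (forall x, x \in S -> 0 <= w x) ->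
  (forall A, (A `<=` S)%fset -> antichain A -> (#|` A| <= N)%N) ->
  exists C, [/\ (C `<=` S)%fset, chain C & \sum_(x <- S) w x <= N%:R * \sum_(x <- C) w x].
Proof.
have [n] := ubnP #|` S|; elim: n S w => // n IH S w card_lt w_ge0 anti_le.
have [S0|S_neq0] := eqVneq S fset0.
  by exists fset0; rewrite S0; split; rewrite ?fsub0set ?big_seq_fset0 ?mulr0 //.
set A := minimals S; have AS : (A `<=` S)%fset := minimals_sub S.
have [e eA e_min] : exists2 e, e \in A & forall x, x \in A -> w e <= w x.
  apply: fset_argmin; have /fset0Pn[x /minimal_below[m mA _]] := S_neq0.
  by apply/fset0Pn; exists m.
have eS := fsubsetP AS e eA; have we_ge0 := w_ge0 e eS.
pose w' x := w x - (if x \in A then w e else 0).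
have w'_ge0 x : x \in S -> 0 <= w' x.
  by rewrite /w' => xS; case: ifP => [/e_min|_]; rewrite subr_ge0 // w_ge0.
have w'_le x : w' x <= w x by rewrite /w' gerBl; case: ifP.
pose S' := [fset x in S | 0 < w' x]%fset.
have S'S : (S' `<=` S)%fset by apply/fsubsetP => x; rewrite !inE => /andP[].
have [|x||C [CS' C_chain C_heavy]] := IH S' w'.
- move: card_lt; rewrite ltnS; apply: leq_trans; apply: fproper_ltn_card.
  rewrite fproperE S'S; apply/fsubsetPn; exists e => //.
  by rewrite !inE /w' eA subrr ltxx andbF.
- by rewrite !inE => /andP[_ /ltW].
- by move=> B BS'; apply: anti_le; exact: fsubset_trans S'S.
have [D [CD DS D_chain [m mD mA]]] := chain_extend S_neq0 (fsubset_trans CS' S'S) C_chain.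
exists D; split=> //.
have D_heavy : \sum_(x <- C) w' x + w e <= \sum_(x <- D) w x.
  apply: (@le_trans _ _ (\sum_(x <- D) w' x + w e)).
    by rewrite lerD2r; apply: ler_sum_fsubset => // x /(fsubsetP DS); exact: w'_ge0.
  rewrite !(big_fsetD1 m mD) /= {1}/w' mA addrAC subrK lerD2l.
  by apply: ler_sum.
have total : \sum_(x <- S) w x <= \sum_(x <- S') w' x + w e * N%:R.
  have -> : \sum_(x <- S) w x = \sum_(x <- S) w' x + \sum_(x <- S) (if x \in A then w e else 0).
    by rewrite -big_split /=; apply: eq_bigr => x _; rewrite subrK.
  rewrite sum_indicator //; apply: lerD (ler_sum_pos_part S w') _.
  by rewrite ler_wpM2l // ler_nat; apply: anti_le => //; exact: minimals_antichain.
apply: le_trans total _; apply: le_trans (lerD C_heavy (lexx _)) _.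
by rewrite (mulrC (w e)) -mulrDr ler_wpM2l.
Qed.

End WeightedMirsky.

Section Cubes.
Variables (X : choiceType) (mu : X -> X -> X -> X).
Hypothesis mu_median : median_algebra mu.
Variable M : {fset X}.
Hypothesis sM : subalgebra mu M.
Implicit Types (h k : {fset X}) (A : {fset {fset X}}) (p q x y z : X).

Local Notation sep := (sep_half mu M).
Local Notation wall_antichain := (antichain (@fsubset X)).

Lemma halfspaces_meet (s : seq {fset X}) : M != fset0 ->
  (forall h, h \in s -> halfspace mu M h) -> {in s &, forall h k, h `&` k != fset0}%fset ->
  exists2 z, z \in M & forall h, h \in s -> z \in h.
Proof.
move=> /fset0Pn[x xM] s_half s_meet.
apply: (@helly X mu mu_median _ s [set` M] (fun h => [set` h])).
- by exists x.
- by move=> h hs z; exact: halfspace_sub (s_half h hs) z.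
- by move=> h hs a b c; exact: halfspace_med_in (s_half h hs).
- move=> h k hs ks; have /fset0Pn[z] := s_meet h k hs ks.
  by rewrite inE => /andP[zh zk]; exists z.
Qed.

Definition closest_pair A p q : Prop :=
  [/\ p \in M, q \in M, (A `<=` sep p q)%fset & forall p' q', p' \in M -> q' \in M ->
     (A `<=` sep p' q')%fset -> (#|` sep p q| <= #|` sep p' q'|)%N].

Lemma closest_pair_exists A x y : x \in M -> y \in M -> (A `<=` sep x y)%fset ->
  exists p q, closest_pair A p q.
Proof.
move=> xM yM Axy; pose separates (pq : M * M) := (A `<=` sep (val pq.1) (val pq.2))%fset.
have sep_xy : separates ([` xM], [` yM])%fset by [].
have [[p q] /= Apq pq_min] := arg_minnP (fun pq : M * M => #|` sep (val pq.1) (val pq.2)|) sep_xy.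
exists (val p), (val q); split; [exact: valP|exact: valP|exact: Apq|].
by move=> p' q' p'M q'M; exact: (pq_min ([` p'M], [` q'M])%fset).
Qed.

Lemma sep_half_between p q z : p \in M -> q \in M -> z \in M -> between mu p q z ->
  (sep p z `<=` sep p q)%fset /\ (sep z q `<=` sep p q)%fset.
Proof.
move=> pM qM zM pqz; have med h (hh : halfspace mu M h) := halfspace_med mu_median sM hh pM qM zM.
split; apply/fsubsetP => h /sep_halfP[hh]; have := med h hh; rewrite pqz => h_med.
  by move=> ph zh; apply/sep_halfP; split=> //; apply: contra zh => qh; rewrite h_med ph ?qh.
move=> zh qh; apply/sep_halfP; split=> //; apply: contraTT zh => ph.
by rewrite h_med (negPf ph) ?(negPf qh).
Qed.

Lemma closest_pair_inner A p q z h : closest_pair A p q -> z \in M ->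
  (forall k, k \in A -> z \in k) -> h \in sep p q -> z \in h.
Proof.
move=> [pM qM Apq pq_min] zM zA hs; have mM := sM pM qM zM.
have [_ sub] := sep_half_between pM qM mM (between_med12 mu_median p q z).
have /eqP sepE : sep (mu p q z) q == sep p q.
  rewrite eqEfcard sub pq_min //; apply/fsubsetP => k kA.
  have /sep_halfP[hk pk qk] := fsubsetP Apq k kA; apply/sep_halfP; split=> //.
  by rewrite (medC23 mu_median) (halfspace_med mu_median sM hk) // pk zA.
move: (hs); rewrite -sepE => /sep_halfP[hh mh qh]; apply: contraTT mh => zh.
by rewrite (med_rot mu_median) (halfspace_med mu_median sM hh) // (negPf qh) (negPf zh).
Qed.

Lemma closest_pair_lower A p q h : closest_pair A p q -> h \in sep p q ->
  exists2 k, k \in A & (k `<=` h)%fset.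
Proof.
move=> pq_closest hs; have [pM qM Apq _] := pq_closest; have /sep_halfP[hh ph qh] := hs.
apply: contrapT => no_lower; have escape k : k \in A -> (k `&` (M `\` h) != fset0)%fset.
  move=> kA; have /fsubsetPn[a ak ah] : ~~ (k `<=` h)%fset.
    by apply/negP => ?; apply: no_lower; exists k.
  have /sep_halfP[hk _ _] := fsubsetP Apq k kA.
  by apply/fset0Pn; exists a; rewrite !inE ak ah (halfspace_sub hk ak).
have [|k|k k'|z zM zs] := @halfspaces_meet (M `\` h :: A)%fset.
- by apply/fset0Pn; exists p.
- rewrite inE => /predU1P[->|/(fsubsetP Apq)/sep_halfP[]//]; exact: halfspaceC.
- rewrite !inE => /predU1P[->|kA] /predU1P[->|k'A].
  + by apply/fset0Pn; exists q; rewrite !inE qM qh.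
  + by rewrite fsetIC escape.
  + exact: escape.
  have [/(fsubsetP Apq)/sep_halfP[_ pk _] /(fsubsetP Apq)/sep_halfP[_ pk' _]] := (kA, k'A).
  by apply/fset0Pn; exists p; rewrite inE pk.
have : z \in (M `\` h)%fset by apply: zs; rewrite inE eqxx.
rewrite inE (closest_pair_inner pq_closest zM _ hs) // => k kA.
by apply: zs; rewrite inE kA orbT.
Qed.

Lemma closest_pair_setC A p q :
  closest_pair A p q -> closest_pair [fset (M `\` k)%fset | k in A]%fset q p.
Proof.
move=> [pM qM Apq pq_min]; split=> // [|p' q' p'M q'M Ap'q'].
  apply/fsubsetP => _ /imfsetP[k /= /(fsubsetP Apq) ks ->]; exact: sep_half_setC.
rewrite (card_sep_half_swap mu pM qM) (card_sep_half_swap mu q'M p'M); apply: pq_min => //.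
apply/fsubsetP => k kA; have /sep_halfP[/and5P[kM _ _ _ _] _ _] := fsubsetP Apq k kA.
rewrite -(fsetDK kM); apply: sep_half_setC => //; apply: (fsubsetP Ap'q').
by apply/imfsetP; exists k.
Qed.

Lemma closest_pair_upper A p q h : closest_pair A p q -> h \in sep p q ->
  exists2 k, k \in A & (h `<=` k)%fset.
Proof.
move=> pq_closest hs; have [pM qM _ _] := pq_closest.
have [_ /imfsetP[k /= kA ->] kh] :=
  closest_pair_lower (closest_pair_setC pq_closest) (sep_half_setC pM qM hs).
exists k => //; apply/fsubsetP => a ah; have /sep_halfP[hh _ _] := hs.
have aM := halfspace_sub hh ah; apply: contraLR ah => ak.
have /(fsubsetP kh) : a \in (M `\` k)%fset by rewrite inE ak aM.
by rewrite inE => /andP[].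
Qed.

Section Antichain.
Variable A : {fset {fset X}}.
Hypothesis A_antichain : wall_antichain A.

Let side (v : pred {fset X}) h : {fset X} := if v h then h else (M `\` h)%fset.

Lemma sides_meet x y (v : pred {fset X}) h k : x \in M -> y \in M -> (A `<=` sep x y)%fset ->
  h \in A -> k \in A -> (side v h `&` side v k != fset0)%fset.
Proof.
move=> xM yM Axy; wlog vhk : h k / v k ==> v h => [sym hA kA|hA kA].
  have [vhk|] := boolP (v k ==> v h); first exact: sym.
  by rewrite negb_imply fsetIC => /andP[_ /negPf vh]; apply: sym; rewrite ?vh.
have /sep_halfP[hh xh yh] := fsubsetP Axy h hA; have /sep_halfP[hk xk yk] := fsubsetP Axy k kA.
move: vhk; rewrite /side; case: (boolP (v h)) => vh; case: (boolP (v k)) => vk //= _.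
- by apply/fset0Pn; exists x; rewrite inE xh.
- have /fsubsetPn[a ah ak] : ~~ (h `<=` k)%fset.
    by apply: contraNN vk => /(A_antichain hA kA) <-.
  by apply/fset0Pn; exists a; rewrite !inE ah ak (halfspace_sub hh ah).
- by apply/fset0Pn; exists y; rewrite !inE yh yk yM.
Qed.

Lemma orthant_nonempty x y (v : pred {fset X}) : x \in M -> y \in M -> (A `<=` sep x y)%fset ->
  exists2 z, z \in M & forall h, h \in A -> (z \in h) = v h.
Proof.
move=> xM yM Axy.
have [|_ /mapP[h hA ->]|_ _ /mapP[h hA ->] /mapP[k kA ->]|z zM zs] :=
    @halfspaces_meet (map (side v) A).
- by apply/fset0Pn; exists x.
- have /sep_halfP[hh _ _] := fsubsetP Axy h hA.
  by rewrite /side; case: ifP => // _; exact: halfspaceC.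
- exact: sides_meet xM yM Axy hA kA.
exists z => // h hA; have := zs _ (map_f (side v) hA).
by rewrite /side; case: (v h); rewrite // inE => /andP[/negbTE].
Qed.

Section ClosestPair.
Variables p q : X.
Hypothesis pq_closest : closest_pair A p q.

(* By Helly, a wall separating a closest pair contains a wall of A and lies in another one. *)
Lemma closest_pair_walls : sep p q = A.
Proof.
apply/eqP; rewrite eqEfsubset; have [_ _ -> _] := pq_closest; rewrite andbT.
apply/fsubsetP => h hs; have [k kA kh] := closest_pair_lower pq_closest hs.
have [k' k'A hk'] := closest_pair_upper pq_closest hs.
have kk' := A_antichain kA k'A (fsubset_trans kh hk').
by suff -> : h = k by []; apply/eqP; rewrite eqEfsubset kh kk' hk'.
Qed.

Let wall (i : 'I_#|` A|) : {fset X} := nth fset0 A i.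

Lemma wall_in i : wall i \in A.
Proof. exact: mem_nth. Qed.

Lemma wall_inj : injective wall.
Proof.
by move=> i j /eqP; rewrite nth_uniq ?fset_uniq // => /eqP; exact: val_inj.
Qed.

Lemma wall_surj h : h \in A -> exists i, h = wall i.
Proof.
move=> hA; have hA' : (index h A < #|` A|)%N by rewrite index_mem.
by exists (Ordinal hA'); rewrite /wall nth_index.
Qed.

Lemma orthant_point (v : 'I_#|` A| -> bool) : exists z, z \in M /\ forall i, (z \in wall i) = v i.
Proof.
have [pM qM Apq _] := pq_closest.
have [z zM zv] := orthant_nonempty (fun h => [exists i, (wall i == h) && v i]) pM qM Apq.
exists z; split=> // i; rewrite zv ?wall_in //.
apply/existsP/idP => [[j /andP[/eqP/wall_inj->]]//|vi].
by exists i; rewrite eqxx.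
Qed.

Lemma cube_edge x y i : x \in M -> y \in M -> between mu p q x -> between mu p q y ->
  x \in wall i -> y \notin wall i -> (forall j, (x \in wall j) = (y \in wall j) \/ j = i) ->
  edge mu M x y.
Proof.
move=> xM yM pqx pqy xi yi same; have [pM qM Apq _] := pq_closest.
have /sep_halfP[hi _ _] := fsubsetP Apq _ (wall_in i).
rewrite /edge xM yM; apply/cardfs1P; exists (wall i); apply/fsetP => g; rewrite inE.
apply/sep_halfP/eqP => [[hg xg yg]|->//].
have med := halfspace_med mu_median sM hg pM qM.
have := med x xM; have := med y yM; rewrite pqx pqy (negPf yg) xg.
case: (boolP (p \in g)) => pg; case: (boolP (q \in g)) => qg.
- by move=> /(_ erefl).
- move=> _ _; have /wall_surj[j gE] : g \in A.
    by rewrite -closest_pair_walls; apply/sep_halfP.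
  by have [|<-//] := same j; rewrite -gE xg (negPf yg).
- move=> _ _; have /wall_surj[j gE] : (M `\` g)%fset \in A.
    rewrite -closest_pair_walls; apply/sep_halfP.
    by split; rewrite ?inE ?pg ?qg //; exact: halfspaceC.
  have [|jE] := same j; first by rewrite -gE !inE xg yg yM.
  by move: xi; rewrite -jE -gE inE xg.
- by move=> _ /(_ erefl).
Qed.

Lemma closest_pair_cube : has_cube mu M #|` A|.
Proof.
have [pM qM Apq _] := pq_closest; have [z zP] := choice orthant_point.
pose f (v : {ffun 'I_#|` A| -> bool}) := mu p q (z v).
have fM v : f v \in M by apply: sM => //; case: (zP v).
have f_wall v i : (f v \in wall i) = v i.
  have [zM z_wall] := zP v; have /sep_halfP[hi pi qi] := fsubsetP Apq _ (wall_in i).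
  have med := halfspace_med mu_median sM hi; rewrite /f -[v i]z_wall.
  case: (boolP (z v \in wall i)) => zi.
    by rewrite (medC23 mu_median) med ?pi ?zi.
  by rewrite (med_rot mu_median) med ?(negPf qi) ?(negPf zi).
have f_edge (v w : {ffun 'I_#|` A| -> bool}) i :
    (forall j, (v j != w j) = (j == i)) -> v i -> edge mu M (f v) (f w).
  move=> vw vi; apply: (@cube_edge _ _ i) => //; rewrite ?f_wall //; try exact: between_med12.
    by have := vw i; rewrite eqxx vi; case: (w i).
  move=> j; rewrite !f_wall; have := vw j; case: (eqVneq j i) => [->|_]; first by right.
  by move/negbFE/eqP; left.
exists f; split=> // [v w fvw|v w /eqP/cards1P[i vw]].
  by apply/ffunP => i; rewrite -!f_wall fvw.
have {}vw j : (v j != w j) = (j == i) by move/setP/(_ j): vw; rewrite !inE.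
have [vi|vi] := boolP (v i); first exact: f_edge vw vi.
rewrite edgeC; apply: (f_edge w v i) => [j|]; first by rewrite eq_sym.
by have := vw i; rewrite eqxx (negPf vi); case: (w i).
Qed.

End ClosestPair.

Lemma antichain_cube x y : x \in M -> y \in M -> (A `<=` sep x y)%fset -> has_cube mu M #|` A|.
Proof.
move=> xM yM /(closest_pair_exists xM yM)[p [q pq_closest]].
exact: closest_pair_cube pq_closest.
Qed.

End Antichain.
End Cubes.

Definition rank_le (X : choiceType) (mu : X -> X -> X -> X) (N : nat) : Prop :=
  forall M n, subalgebra mu M -> has_cube mu M n -> (n <= N)%N.

Section ChainHeight.
Variables (R : realType) (X : choiceType) (d : X -> X -> R) (mu : X -> X -> X -> X).
Hypotheses (mu_median : median_algebra mu) (d_metric : is_metric d).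
Implicit Types (M h k : {fset X}) (C : {fset {fset X}}) (w : {fset X} -> R) (p q x y z : X).

Definition chain_height C w p : R := \sum_(h <- C | p \notin h) w h.

Section Chain.
Variables (M : {fset X}) (C : {fset {fset X}}).
Hypotheses (sM : subalgebra mu M) (C_half : forall h, h \in C -> halfspace mu M h).

Let below p q := forall h, h \in C -> p \notin h -> q \notin h.

Lemma chain_height_le w p q : (forall h, 0 <= w h) -> below p q ->
  chain_height C w p <= chain_height C w q.
Proof.
move=> w_ge0 pq; rewrite /chain_height big_seq_cond [leRHS]big_seq_cond.
rewrite big_mkcond [leRHS]big_mkcond /=; apply: ler_sum => h _.
by case: ifP => [/andP[hC ph]|_]; [rewrite hC pq|case: ifP].
Qed.

Lemma below_total p q : chain (@fsubset X) C -> below p q \/ below q p.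
Proof.
move=> C_chain; have [|not_pq] := pselect (below p q); [by left|right] => k kC qk.
apply/negP => pk; apply: not_pq => h hC ph; apply/negP => qh.
case/orP: (C_chain h k hC kC) => /fsubsetP sub; first by rewrite sub in qk.
by rewrite sub in ph.
Qed.

Lemma below_between x y z : x \in M -> y \in M -> z \in M -> between mu x y z ->
  below x y -> below x z /\ below z y.
Proof.
move=> xM yM zM xyz xy; split=> h hC; have := halfspace_med mu_median sM (C_half hC) xM yM zM;
  rewrite xyz => h_med.
  by move=> xh; rewrite h_med (negPf xh) ?(negPf (xy h hC xh)).
move=> zh; apply/negP => yh; have [xh|xh] := boolP (x \in h).
  by rewrite h_med xh ?yh in zh.
by have := xy h hC xh; rewrite yh.
Qed.

Lemma chain_height_monotone w : (forall h, 0 <= w h) -> chain (@fsubset X) C ->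
  interval_monotone mu [set` M] (chain_height C w).
Proof.
move=> w_ge0 C_chain; have height_le := chain_height_le w_ge0.
have mono x y z : x \in M -> y \in M -> z \in M -> between mu x y z -> below x y ->
    chain_height C w x <= chain_height C w z <= chain_height C w y.
  by move=> xM yM zM xyz /(below_between xM yM zM xyz)[xz zy]; rewrite !height_le.
move=> x y z xM yM zM xyz; have [xy|yx] := below_total x y C_chain.
  have /andP[xz zy] := mono x y z xM yM zM xyz xy; have le_xy := le_trans xz zy.
  by rewrite (min_idPl le_xy) (max_idPr le_xy) xz.
have /andP[yz zx] := mono y x z yM xM zM (betweenC mu_median xyz) yx; have le_yx := le_trans yz zx.
by rewrite (min_idPr le_yx) (max_idPl le_yx) yz.
Qed.

Lemma chain_height_lipschitz p q : p \in M -> q \in M ->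
  chain_height C (lambda_max d mu M) p - chain_height C (lambda_max d mu M) q <= dM d mu M q p.
Proof.
move=> pM qM; have lambda_ge0 := lambda_max_ge0 mu d_metric M; rewrite dM_in //.
apply: (@le_trans _ _ (\sum_(h <- C | (q \in h) && (p \notin h)) lambda_max d mu M h)).
  rewrite lerBlDr /chain_height (bigID (fun h => q \in h)) /= lerD //.
    by under eq_bigl do rewrite andbC.
  rewrite big_mkcond [leRHS]big_mkcond; apply: ler_sum => h _ /=.
  by case: (p \notin h); case: (q \notin h) => /=.
rewrite big_fset_condE /=; apply: ler_sum_fsubset => //.
apply/fsubsetP => h /imfsetP[k /= /andP[kC /andP[qk pk]] ->].
by apply/sep_halfP; split=> //; exact: C_half.
Qed.

End Chain.

Lemma chain_function N M x y : rank_le mu N -> subalgebra mu M -> x \in M -> y \in M ->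
  exists f : X -> R, [/\ interval_monotone mu [set` M] f,
    {in M &, forall p q, f p - f q <= dM d mu M q p}, f x = 0 & dM d mu M x y <= N%:R * f y].
Proof.
move=> rank sM xM yM; have lambda_ge0 := lambda_max_ge0 mu d_metric M.
have fsubset_anti : antisymmetric (@fsubset X) by move=> h k; rewrite -eqEfsubset => /eqP.
have [h _|A Asub A_anti|C [Csub C_chain C_heavy]] := @heavy_chain R _ (@fsubset X) (@fsubset_refl X)
    (@fsubset_trans X) fsubset_anti N (sep_half mu M x y) (lambda_max d mu M).
- exact: lambda_ge0.
- by apply: (rank M) => //; exact: antichain_cube Asub.
have C_sep h (hC : h \in C) := elimT (sep_halfP _ _ _ _ _) (fsubsetP Csub h hC).
have C_half h : h \in C -> halfspace mu M h by case/C_sep.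
exists (chain_height C (lambda_max d mu M)); split.
- exact: chain_height_monotone.
- by move=> p q pM qM; exact: chain_height_lipschitz.
- by rewrite /chain_height big_seq_cond big1 // => h /andP[/C_sep[_ ->]].
- suff -> : chain_height C (lambda_max d mu M) y = \sum_(h <- C) lambda_max d mu M h.
    by rewrite dM_in.
  rewrite /chain_height big_seq_cond [RHS]big_seq; apply: eq_bigl => h.
  by rewrite andb_idr // => /C_sep[].
Qed.

End ChainHeight.

Section Embedding.
Variables (R : realType) (X : choiceType) (d : X -> X -> R) (mu : X -> X -> X -> X).
Hypotheses (mu_median : median_algebra mu) (d_metric : is_metric d).
Variable g : X -> X.
Hypotheses (g_isom : forall x y, d (g x) (g y) = d x y)
  (g_mu : forall x y z, g (mu x y z) = mu (g x) (g y) (g z)).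
Implicit Types (M h k : {fset X}) (x y : X).

Let im h : {fset X} := [fset g x | x in h]%fset.

Lemma embedding_inj : injective g.
Proof.
by move=> x y gxy; apply: (metric_le0 d_metric); rewrite -g_isom gxy (metricxx d_metric).
Qed.

Lemma mem_im h x : (g x \in im h) = (x \in h).
Proof. exact/mem_imfset/embedding_inj. Qed.

Lemma im_inj : injective im.
Proof. by move=> h k hk; apply/fsetP => x; rewrite -mem_im hk mem_im. Qed.

Lemma subalgebra_im M : subalgebra mu M -> subalgebra mu (im M).
Proof.
move=> sM _ _ _ /imfsetP[x /= xM ->] /imfsetP[y /= yM ->] /imfsetP[z /= zM ->].
by rewrite -g_mu mem_im; exact: sM.
Qed.

Lemma sep_half_im M x y h : subalgebra mu M -> x \in M -> y \in M -> h \in sep_half mu M x y ->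
  im h \in sep_half mu (im M) (g x) (g y).
Proof.
move=> sM xM yM /sep_halfP[hh xh yh]; apply/sep_halfP; rewrite !mem_im; split=> //.
have -> : im h = [fset z in im M | z \in im h]%fset.
  apply/fsetP => z; rewrite !inE; apply/esym/andb_idl => /imfsetP[t /= th ->].
  by rewrite mem_im (halfspace_sub hh).
apply: (@halfspace_intro _ mu _ (mem (im h)) (g x) (g y)); rewrite ?inE ?mem_im //.
move=> _ _ _ /imfsetP[a /= aM ->] /imfsetP[b /= bM ->] /imfsetP[c /= cM ->].
by rewrite -g_mu /= !mem_im; exact: (halfspace_med mu_median sM hh).
Qed.

Lemma sep_half_preim M x y k : subalgebra mu M -> x \in M -> y \in M ->
  k \in sep_half mu (im M) (g x) (g y) -> exists2 h, h \in sep_half mu M x y & k = im h.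
Proof.
move=> sM xM yM /sep_halfP[hk xk yk]; exists [fset z in M | g z \in k]%fset.
  apply/sep_halfP; rewrite !inE xM yM xk (negPf yk); split=> //.
  apply: (@halfspace_intro _ mu _ (fun z => g z \in k) x y) => // a b c aM bM cM.
  by rewrite g_mu; apply: (halfspace_med mu_median (subalgebra_im sM) hk); rewrite mem_im.
apply/fsetP => z; apply/idP/imfsetP => [zk|[t /=]].
  have /imfsetP[t /= tM zt] := halfspace_sub hk zk.
  by exists t; rewrite // !inE tM -zt.
by rewrite !inE => /andP[_ tk] ->.
Qed.

Lemma sep_half_imE M x y : subalgebra mu M -> x \in M -> y \in M ->
  sep_half mu (im M) (g x) (g y) = [fset im h | h in sep_half mu M x y]%fset.
Proof.
move=> sM xM yM; apply/fsetP => k; apply/idP/imfsetP => [ks|[h /= hs ->]].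
  by have [h hs kE] := sep_half_preim sM xM yM ks; exists h.
exact: sep_half_im.
Qed.

Lemma edge_im M x y : subalgebra mu M -> edge mu (im M) (g x) (g y) = edge mu M x y.
Proof.
move=> sM; rewrite /edge !mem_im.
case: (boolP (x \in M)) => xM //; case: (boolP (y \in M)) => yM //=.
by rewrite sep_half_imE // [in LHS]card_imfset //; exact: im_inj.
Qed.

Lemma lambda_max_im M h : subalgebra mu M -> lambda_max d mu (im M) (im h) = lambda_max d mu M h.
Proof.
move=> sM; apply: le_anti; apply/andP; split;
  apply: lambda_max_le => [|a b ab]; rewrite ?(lambda_max_ge0 mu d_metric) //.
  have/and3P[/imfsetP[x /= _ aE] /imfsetP[y /= _ bE] _] := ab; move: ab; rewrite aE bE.
  by rewrite edge_im // !mem_im g_isom; exact: lambda_max_ge.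
by move=> ah bh; rewrite -g_isom; apply: lambda_max_ge; rewrite ?edge_im ?mem_im.
Qed.

Lemma dM_im M x y : subalgebra mu M -> dM d mu (im M) (g x) (g y) = dM d mu M x y.
Proof.
move=> sM; rewrite /dM !mem_im; case: ifP => // /andP[xM yM].
rewrite sep_half_imE // [LHS]big_imfset /=; last by move=> ? ? _ _; exact: im_inj.
by apply: eq_bigr => h _; exact: lambda_max_im.
Qed.

End Embedding.

(** * The rectified metric *)

Section LargeSubalgebras.
Variables (X : choiceType) (mu : X -> X -> X -> X).
Hypothesis mu_median : median_algebra mu.

Definition large_subalgebras : set_system {fset X} := fun P =>
  exists2 M0, subalgebra mu M0 & forall M, subalgebra mu M -> {subset M0 <= M} -> P M.

Lemma large_subalgebras_proper : ProperFilter large_subalgebras.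
Proof.
split; first by move=> [M0 sM0 /(_ M0 sM0)]; apply.
split; first by exists fset0 => //; exact: subalgebra0.
  move=> P Q [M1 sM1 P_M1] [M2 sM2 Q_M2].
  have [M0 [sM0 M10 M20]] := subalgebra_extend mu_median M2 sM1.
  exists M0 => // M sM M0M; split; [apply: P_M1|apply: Q_M2] => // x.
    by move/M10/M0M.
  by move/M20/M0M.
by move=> P Q PQ [M0 sM0 P_M0]; exists M0 => // M sM M0M; exact/PQ/P_M0.
Qed.

Lemma near_large_subalgebras (s : seq X) :
  \forall M \near large_subalgebras, subalgebra mu M /\ {subset s <= M}.
Proof.
have [M0 [sM0 sM0s]] := subalgebra_gen mu_median s.
by exists M0 => // M sM M0M; split=> // x /sM0s/M0M.
Qed.

End LargeSubalgebras.

Section Delta.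
Variables (R : realType) (X : choiceType) (d : X -> X -> R) (mu : X -> X -> X -> X).
Hypotheses (mu_median : median_algebra mu) (d_metric : is_metric d).
Hypothesis d_mu_fin : forall x y, d_mu d mu x y \is a fin_num.

Local Notation large := (large_subalgebras mu).
Let large_proper : ProperFilter large := large_subalgebras_proper mu_median.
#[local] Existing Instance large_proper.

Definition delta x y : R := fine (d_mu d mu x y).

Lemma deltaE x y : (delta x y)%:E = d_mu d mu x y.
Proof. by rewrite fineK. Qed.

Lemma dM_le_delta M x y : subalgebra mu M -> dM d mu M x y <= delta x y.
Proof. by move=> sM; rewrite -lee_fin deltaE; apply: ereal_sup_ubound; exists M. Qed.

Lemma dM_cvg_delta x y : dM d mu M x y @[M --> large] --> delta x y.
Proof.
apply/cvgrPdist_lt => e e_gt0.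
have : ((delta x y - e)%:E < d_mu d mu x y)%E by rewrite -deltaE lte_fin gtrBl.
move=> /ereal_sup_gt[_ [M0 sM0 <-]]; rewrite lte_fin => M0_lt.
have [M1 [sM1 M01 /= M1xy]] := subalgebra_extend mu_median [:: x; y] sM0.
exists M1 => // M sM M1M; have M_le := dM_le_delta x y sM.
rewrite ger0_norm ?subr_ge0 // ltrBlDr -ltrBlDl.
apply: lt_le_trans M0_lt _.
have [/andP[xM0 yM0]|/dM_out->] := boolP ((x \in M0) && (y \in M0)); last exact: dM_ge0.
by apply: dM_mono => // z /M01/M1M.
Qed.

Lemma near_large (s : seq X) : \forall M \near large, subalgebra mu M /\ {subset s <= M}.
Proof. exact: near_large_subalgebras. Qed.

Lemma near_large_pair x y : \forall M \near large, [/\ subalgebra mu M, x \in M & y \in M].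
Proof.
apply: filterS (near_large [:: x; y]) => M [sM xyM].
by split=> //; apply: xyM; rewrite !inE eqxx ?orbT.
Qed.

Lemma d_le_delta x y : d x y <= delta x y.
Proof.
apply: (cvgr_to_ge (@dM_cvg_delta x y)).
by apply: filterS (near_large_pair x y) => M [sM xM yM]; exact: d_le_dM.
Qed.

Lemma deltaxx x : delta x x = 0.
Proof.
apply: (cvg_unique (@norm_hausdorff _ R) (@dM_cvg_delta x x)).
by rewrite /=; under eq_cvg do rewrite dMxx; exact: cvg_cst.
Qed.

Lemma deltaC x y : delta x y = delta y x.
Proof.
apply: (cvg_unique (@norm_hausdorff _ R) (@dM_cvg_delta x y)).
by rewrite /=; under eq_cvg do rewrite (dMC mu d_metric); exact: dM_cvg_delta.
Qed.

Lemma delta_between : additive_on_intervals mu delta.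
Proof.
move=> x y z xyz; apply: (cvg_unique (@norm_hausdorff _ R) (@dM_cvg_delta x y)).
apply: cvg_trans (near_eq_cvg _) (cvgD (@dM_cvg_delta x z) (@dM_cvg_delta z y)).
apply: filterS (near_large [:: x; y; z]) => M [sM xyzM].
by apply/esym/dM_between => //; apply: xyzM; rewrite !inE eqxx ?orbT.
Qed.

Lemma delta_triangle x y z : delta x z <= delta x y + delta y z.
Proof.
set m := mu x z y.
have := delta_between (between_med12 mu_median x z y).
have := delta_between (between_med13 mu_median x z y).
have := delta_between (between_med23 mu_median x z y).
have := le_trans (metric_ge0 d_metric y m) (d_le_delta y m).
by rewrite -/m (deltaC z y) (deltaC z m) (deltaC m y); lra.
Qed.

Lemma delta_metric : is_metric delta.
Proof.
split=> [x y|x y||]; [|split=> [xy0|->]|exact: deltaC|exact: delta_triangle].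
- exact: le_trans (metric_ge0 d_metric x y) (d_le_delta x y).
- by apply: (metric_le0 d_metric); rewrite -xy0 d_le_delta.
- exact: deltaxx.
Qed.

Lemma delta_embedding g x y : (forall x y, d (g x) (g y) = d x y) ->
  (forall x y z, g (mu x y z) = mu (g x) (g y) (g z)) -> delta x y <= delta (g x) (g y).
Proof.
move=> g_isom g_mu; apply: (cvgr_to_le (@dM_cvg_delta x y)).
apply: filterS (near_large [::]) => M [sM _].
rewrite -(dM_im mu_median d_metric g_isom g_mu x y sM).
by apply: dM_le_delta; exact: (subalgebra_im d_metric g_isom g_mu sM).
Qed.

Lemma dM_walls M x y : x \in M -> y \in M -> dM d mu M x y =
  \sum_(h <- fpowerset M | halfspace mu M h)
    (if (x \in h) == (y \in h) then 0 else lambda_max d mu M h / 2).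
Proof.
move=> xM yM; have -> : dM d mu M x y = (dM d mu M x y + dM d mu M y x) / 2.
  by rewrite (dMC mu d_metric M y x); lra.
rewrite !dM_halfspaces // -big_split /= mulr_suml; apply: eq_bigr => h _.
by case: (x \in h); case: (y \in h); rewrite /= ?addr0 ?add0r ?mul0r.
Qed.

Definition wall_kernel M (t : R) x y : R :=
  \prod_(h <- fpowerset M | halfspace mu M h)
    (if (x \in h) == (y \in h) then 1 else expR (- (t * (lambda_max d mu M h / 2)))).

Lemma wall_kernelE M t x y : x \in M -> y \in M ->
  wall_kernel M t x y = exp_kernel (dM d mu M) t x y.
Proof.
move=> xM yM; rewrite /exp_kernel dM_walls // mulr_sumr -sumrN expR_sum.
by apply: eq_bigr => h _; case: ifP; rewrite ?mulr0 ?oppr0 ?expR0.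
Qed.

Lemma exp_kernel_delta_pos_def t : 0 <= t -> pos_def (exp_kernel delta t).
Proof.
move=> t_ge0; apply: (@pos_def_cvg _ _ _ large _ (fun M => wall_kernel M t)) => [M|x y].
  apply: (@pos_def_prod_walls _ _ _ _ _ (fun h => mem h)) => h.
  by rewrite expR_ge0 expR_le1 oppr_le0 mulr_ge0 // divr_ge0 // lambda_max_ge0.
have exp_cvg : exp_kernel (dM d mu M) t x y @[M --> large] --> exp_kernel delta t x y.
  apply: (continuous_cvg _ (@continuous_expR R _)).
  exact: cvgN (cvgM (cvg_cst t) (@dM_cvg_delta x y)).
apply: cvg_trans (near_eq_cvg _) exp_cvg.
by apply: filterS (near_large_pair x y) => M [_ xM yM]; rewrite wall_kernelE.
Qed.

End Delta.

Section Ultralimit.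
Variables (R : realType) (T : Type).

Lemma ultra_bounded_cvg (G : set_system T) (u : T -> R) (c : R) : UltraFilter G ->
  (\forall i \near G, `|u i| <= c) -> cvg (u i @[i --> G]).
Proof.
move=> UG u_le; have [|l [_ u_l]] := @segment_compact R (- c) c (u @ G) _.
  by apply: filterS u_le => i; rewrite /= in_itv /= ler_norml.
apply/cvg_ex; exists l; apply/cvgrPdist_lt => e e_gt0.
have [//|far] := in_ultra_setVsetC [set i | `|l - u i| < e] UG.
have [||r [/= r_far r_near]] := u_l [set r | ~ `|l - r| < e] [set r | `|l - r| < e].
- exact: far.
- by apply/nbhs_ballP; exists e.
- by case: r_far.
Qed.

Lemma cvg_le_near {F : set_system T} {FF : ProperFilter F} (u v : T -> R) (l m : R) :
  u i @[i --> F] --> l -> v i @[i --> F] --> m -> (\forall i \near F, u i <= v i) -> l <= m.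
Proof.
move=> ul vm uv; rewrite -subr_ge0; apply: (cvgr_to_ge (cvgB vm ul)).
by apply: filterS uv => i; rewrite /= subr_ge0.
Qed.

Lemma cvg_min {F : set_system T} {FF : Filter F} (u v : T -> R) (l m : R) :
  u i @[i --> F] --> l -> v i @[i --> F] --> m -> Num.min (u i) (v i) @[i --> F] --> Num.min l m.
Proof. exact: continuous2_cvg (@min_continuous _ R (l, m)). Qed.

Lemma cvg_max {F : set_system T} {FF : Filter F} (u v : T -> R) (l m : R) :
  u i @[i --> F] --> l -> v i @[i --> F] --> m -> Num.max (u i) (v i) @[i --> F] --> Num.max l m.
Proof. exact: continuous2_cvg (@max_continuous _ R (l, m)). Qed.

End Ultralimit.

Section FiniteRank.
Variables (R : realType) (X : choiceType) (d : X -> X -> R) (mu : X -> X -> X -> X) (N : nat).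
Hypotheses (mu_median : median_algebra mu) (d_metric : is_metric d) (mu_rank : rank_le mu N).
Hypothesis d_mu_fin : forall x y, d_mu d mu x y \is a fin_num.

Local Notation delta := (delta d mu).

Lemma chain_functions x y : exists phi : {fset X} -> X -> R, forall s : seq X,
  \forall M \near large_subalgebras mu, [/\ {subset s <= M},
    interval_monotone mu [set` M] (phi M), {in M &, forall p q, phi M p - phi M q <= delta q p},
    phi M x = 0 & dM d mu M x y <= N%:R * phi M y].
Proof.
have phi_exists M : exists f : X -> R, subalgebra mu M -> x \in M -> y \in M ->
    [/\ interval_monotone mu [set` M] f, {in M &, forall p q, f p - f q <= dM d mu M q p},
        f x = 0 & dM d mu M x y <= N%:R * f y].
  have [[sM xM yM]|no] := pselect [/\ subalgebra mu M, x \in M & y \in M].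
    by have [f f_chain] := chain_function mu_median d_metric mu_rank sM xM yM; exists f.
  by exists (fun=> 0) => sM xM yM; case: no.
have [phi phi_chain] := choice phi_exists; exists phi => s.
have large_proper := large_subalgebras_proper mu_median.
apply: filterS (near_large_subalgebras mu_median [:: x, y & s]) => M [sM xysM].
have [||mono lip phi_x heavy] := phi_chain M sM; [by apply: xysM; rewrite !inE eqxx ?orbT..|].
split=> // [p sp|p q pM qM]; first by apply: xysM; rewrite !inE sp !orbT.
exact: le_trans (lip p q pM qM) (dM_le_delta d_mu_fin q p sM).
Qed.

(* The ultralimit over finite subalgebras of the functions attached to heavy chains of walls. *)
Lemma limit_function x y :
  exists2 f : X -> R, monotone_lipschitz mu delta f & delta x y <= N%:R * (f y - f x).
Proof.
have large_proper := large_subalgebras_proper mu_median.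
have [G [UG largeG]] := ultraFilterLemma large_proper.
have [phi large_phi] := chain_functions x y; have near_phi s := largeG _ (large_phi s).
have phi_cvg p : cvg (phi M p @[M --> G]).
  apply: (@ultra_bounded_cvg _ _ G _ (delta p x)); apply: filterS (near_phi [:: p; x]) => M.
  case=> pxM _ lip phi_x _.
  have [pM xM] : p \in M /\ x \in M by split; apply: pxM; rewrite !inE eqxx ?orbT.
  have := lip p x pM xM; have := lip x p xM pM; rewrite phi_x subr0 sub0r => ? lip_px.
  by rewrite ler_norml lerNl (deltaC mu_median d_metric d_mu_fin p x) lip_px andbT deltaC.
pose f p := lim (phi M p @[M --> G]).
have phi_f p : phi M p @[M --> G] --> f p := phi_cvg p.
exists f; first split=> [p q z _ _ _ pqz|p q].
- have near_mono : \forall M \near G,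
      Num.min (phi M p) (phi M q) <= phi M z <= Num.max (phi M p) (phi M q).
    apply: filterS (near_phi [:: p; q; z]) => M [pqzM mono _ _ _].
    by apply: mono pqz; apply: pqzM; rewrite !inE eqxx ?orbT.
  apply/andP; split.
    apply: (cvg_le_near (cvg_min (phi_f p) (phi_f q)) (phi_f z)).
    by apply: filterS near_mono => M /andP[].
  apply: (cvg_le_near (phi_f z) (cvg_max (phi_f p) (phi_f q))).
  by apply: filterS near_mono => M /andP[].
- apply: (cvgr_to_le (cvgB (phi_f p) (phi_f q))).
  apply: filterS (near_phi [:: p; q]) => M [pqM _ lip _ _].
  by rewrite /= deltaC //; apply: lip; apply: pqM; rewrite !inE eqxx ?orbT.
- have dM_cvg : dM d mu M x y @[M --> G] --> delta x y.
    exact: cvg_trans (cvg_app _ largeG) (@dM_cvg_delta _ _ _ _ mu_median d_metric d_mu_fin x y).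
  apply: (cvg_le_near dM_cvg (cvgM (cvg_cst (N%:R : R)) (cvgB (phi_f y) (phi_f x)))).
  apply: filterS (near_phi [::]) => M [_ _ _ phi_x heavy].
  by suff : dM d mu M x y <= N%:R * (phi M y - phi M x) by []; rewrite phi_x subr0.
Qed.

Lemma delta_le_dinf x y : delta x y <= N%:R * dinf mu delta x y.
Proof.
have [f f_ml f_heavy] := limit_function x y.
by apply: le_trans f_heavy _; rewrite ler_wpM2l // dinf_ge.
Qed.

End FiniteRank.

Lemma d_mu_fin_num (R : realType) (X : choiceType) (d : X -> X -> R) (mu : X -> X -> X -> X)
    (L : R) x y :
  (d_mu d mu x y <= (L * d x y)%:E)%E -> d_mu d mu x y \is a fin_num.
Proof.
move=> le_L; rewrite fin_numE; apply/andP; split; last first.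
  by rewrite lt_eqF // (le_lt_trans le_L) ?ltry.
rewrite gt_eqF // (lt_le_trans (ltNyr 0)) //; apply: ereal_sup_ubound.
by exists fset0; [exact: subalgebra0|rewrite dM_out].
Qed.

Lemma delta_isometric_action (R : realType) (X : choiceType) (d : X -> X -> R)
    (mu : X -> X -> X -> X) (H : Type) (mul : H -> H -> H) (one : H) (inv : H -> H)
    (act : H -> X -> X) :
  median_algebra mu -> is_metric d -> (forall x y, d_mu d mu x y \is a fin_num) ->
  is_group mul one inv -> isometric_action mul one d mu act ->
  isometric_action mul one (delta d mu) mu act.
Proof.
move=> mu_median d_metric d_mu_fin [_ _ invP] [act1 actM act_d act_mu]; split=> // g x y.
have le_act h u v := delta_embedding mu_median d_metric d_mu_fin u v (act_d h) (act_mu h).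
have actK u : act (inv g) (act g u) = u by rewrite -actM (invP g).1.
by apply: le_anti; rewrite le_act andbT -{2}(actK x) -{2}(actK y) le_act.
Qed.

Theorem theorem3p7 (R : realType) (H : Type) (mul : H -> H -> H) (one : H) (inv : H -> H)
    (X : choiceType) (d : X -> X -> R) (mu : X -> X -> X -> X) (act : H -> X -> X) :
  is_group mul one inv ->
  property_T R mul one inv ->
  metric_median_algebra d mu ->
  uniformly_rectifiable d mu ->
  finite_rank mu ->
  metric_complete d ->
  metric_connected d ->
  isometric_action mul one d mu act ->
  exists x : X, forall g : H, act g x = x.
Proof.
move=> H_group H_propT [mu_median d_metric _] [L L_ge0 d_mu_le] [N mu_rank].
move=> complete connected act_isom.
have d_mu_fin x y := d_mu_fin_num (d_mu_le x y).
have delta_le x y : delta d mu x y <= L * d x y by rewrite -lee_fin deltaE.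
have [[x0 _] _] := connected.
have delta_m := delta_metric mu_median d_metric d_mu_fin.
have act_delta := delta_isometric_action mu_median d_metric d_mu_fin H_group act_isom.
have [act1 actM act_dist _] := act_delta.
have [C orbit_le] := property_T_bounded_orbit x0 H_group H_propT delta_m
  (exp_kernel_delta_pos_def mu_median d_metric d_mu_fin) act1 actM act_dist.
apply: (bounded_orbit_fixed_point mu_median delta_m (delta_between mu_median d_metric d_mu_fin) _ _
  (delta_le_dinf mu_median d_metric mu_rank d_mu_fin) _ H_group act_delta (x0 := x0)
  (Delta := Num.max C 1)) => //.
- exact: (metric_connected_lipschitz d_metric L_ge0 delta_le).
- apply: (metric_complete_bilipschitz d_metric L_ge0 delta_le) complete.
  exact: d_le_delta.
- by rewrite lt_max ltr01 orbT.
- by move=> g; rewrite le_max orbit_le.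
Qed.
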